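(* Let Assumption A hold, let $x^*$ be the unique optimal solution of the bilevel problem, and let $x_K$ be generated by $K$ iterations of R-VFISTA$_s$ (see context) with constant regularization parameter $\eta>0$. (1) Let $\eta=\frac{L_h+\bar\eta L_f}{\mu_f}\left(\frac{(p+1)\ln(K)}{K}\right)^2$, where $\bar\eta>0$ and $p>2$ are arbitrary. Put $u_6:=\bar f(x_0)-\bar f^*+\frac{\mu_f}{2}\|x_0-x^*\|^2$, $u_7:=\frac{\mu_f(\bar h(x_0)-\bar h^* )}{(L_h+\bar\eta L_f)(p+1)}$, $u_8:=\frac{(\bar f(\Pi_{X^*_{\bar h}}[x_0])-\hat C_{\bar f})(L_h+\bar\eta L_f)(p+1)^2}{\mu_f}$, $u_9:=\frac{(L_h+\bar\eta L_f)(p+1)^2\left(\bar f(x_0)-\hat C_{\bar f}+\frac12\mu_f\mathrm{dist}^2(x_0,X^*_{\bar h})\right)}{\mu_f}$, $u_{10}:=\bar h(x_0)-\bar h^*$, and $$R_K:=u_8\left(\frac{\ln(K)}{K}\right)^2+\frac{u_9(\ln(K))^2}{K^{p+3}}+\frac{u_{10}}{K^{p+1}}.$$ Then, for $K$ satisfying $\frac{(L_h+\bar\eta L_f)(p+1)^2}{\mu_f\bar\eta}\le\left(\frac{K}{\ln(K)}\right)^2$ and any $\tilde\nabla\bar f(x^* )\in\partial\bar f(x^* )$: (1.i) [suboptimality bounds] $-\|\tilde\nabla\bar f(x^* )\|\,\mathrm{dist}(x_K,X^*_{\bar h})+\frac{\mu_f}{2}\|x_K-x^*\|^2\le\bar f(x_K)-\bar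 f^*\le\frac{u_6}{K^{p+1}}+\frac{u_7}{K^{p-1}\ln(K)}$. (1.ii) [infeasibility bounds] $0\le\bar h(x_K)-\bar h^*\le R_K$. (1.iii) [distance to optimal solution] If $X^*_{\bar h}$ is $\alpha$-weak sharp minima of order $m\ge1$, then $\frac{\mu_f}{2}\|x_K-x^*\|^2\le\frac{u_6}{K^{p+1}}+\frac{u_7}{K^{p-1}\ln(K)}+\frac{\|\tilde\nabla\bar f(x^* )\|}{\sqrt[m]{\alpha}}\sqrt[m]{R_K}$. (1.iv) [suboptimality lower bound] If $X^*_{\bar h}$ is $\alpha$-weak sharp minima of order $m\ge1$, then $-\frac{\|\tilde\nabla\bar f(x^* )\|}{\sqrt[m]{\alpha}}\sqrt[m]{R_K}\le\bar f(x_K)-\bar f^*$. (2) Assume that $X^*_{\bar h}$ is $\alpha$-weak sharp minima of order $m=1$ and let $\eta\le\frac{\alpha}{2\|\tilde\nabla\bar f(x^* )\|}$ for some $\tilde\nabla\bar f(x^* )\in\partial\bar f(x^* )$. Let $u_{11}:=\bar f(x_0)-\bar f^*+\frac{\bar h(x_0)-\bar h^*}{\eta}+\frac{\mu_f\|x_0-x^*\|^2}{2}$ and $\kappa:=\frac{L_h+\eta L_f}{\eta\mu_f}$. Then, for any $K\ge1$: (2.i) [infeasibility bounds] $0\le\bar h(x_K)-\bar h^*\le2\eta u_{11}\left(1-\frac{1}{\sqrt\kappa}\right)^K$. (2.ii) [distance to the lower-level solution set] $\mathrm{dist}(x_K,X^*_{\bar h})\le\frac{2\eta u_{11}}{\alpha}\left(1-\frac1{\sqrt\kappa}\right)^K$.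 (2.iii) [suboptimality bounds] $-u_{11}\left(1-\frac1{\sqrt\kappa}\right)^K\le\bar f(x_K)-\bar f^*\le u_{11}\left(1-\frac1{\sqrt\kappa}\right)^K$. (2.iv) [distance to optimal solution] $\|x_K-x^*\|^2\le\frac{4u_{11}}{\mu_f}\left(1-\frac1{\sqrt\kappa}\right)^K$.
   Context: Problem: minimize $\bar f(x):=f(x)+\omega_f(x)$ over $x\in X^*_{\bar h}:=\arg\min_{x\in\mathbb{R}^n}\bar h(x)$, where $\bar h:=h+\omega_h$. Norms are Euclidean. Assumption A: (i) $f:\mathbb{R}^n\to\mathbb{R}$ is $L_f$-smooth (differentiable with $L_f$-Lipschitz gradient) and $\mu_f$-strongly convex; (ii) $h:\mathbb{R}^n\to\mathbb{R}$ is $L_h$-smooth and convex; (iii) $\omega_f,\omega_h:\mathbb{R}^n\to(-\infty,\infty]$ are proper, closed, and convex; (iv) $X^*_{\bar h}$ is nonempty; (v) $\hat C_{\bar f}:=\inf_{x\in\mathbb{R}^n}\bar f(x)>-\infty$; (vi) $x^*\in\mathrm{int}(\mathrm{dom}(\omega_f))$, where $x^*$ is the unique optimal solution of the problem; (vii) $\mathrm{ri}(\mathrm{dom}(\omega_f))\cap X^*_{\bar h}\ne\emptyset$. Notation: $\bar h^*:=\inf_{x\in\mathbb{R}^n}\bar h(x)$, $\bar f^*:=\bar f(x^* )$ is the optimal value of the problem, $\omega_\eta:=\omega_h+\eta\omega_f$, $\mathrm{prox}_{\phi}[x]:=\arg\min_u\{\phi(u)+\frac12\|u-x\|^2\}$,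 $\Pi_X$ is Euclidean projection onto $X$, $\partial\bar f(x^* )$ is the convex subdifferential. $X^*_{\bar h}$ is $\alpha$-weak sharp minima of order $m$ if $\alpha>0$ and $\bar h(x)-\bar h^*\ge\alpha\,\mathrm{dist}^m(x,X^*_{\bar h})$ for all $x\in\mathbb{R}^n$. R-VFISTA$_s$: given $y_0=x_0\in\mathbb{R}^n$ and constant $\eta>0$, put $\kappa:=\frac{L_h+\eta L_f}{\eta\mu_f}$, $\gamma:=\frac{1}{L_h+\eta L_f}$, and for $k=0,\dots,K-1$: $x_{k+1}:=\mathrm{prox}_{\gamma\omega_{\eta}}[y_k-\gamma(\nabla h(y_k)+\eta\nabla f(y_k))]$, $y_{k+1}:=x_{k+1}+\frac{\sqrt{\kappa}-1}{\sqrt{\kappa}+1}(x_{k+1}-x_k)$.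
   Formalization: ''Any/some subgradient in ∂f̄(x* )'' is restricted to subgradients g with ⟨g, z−x*⟩ ≥ 0 for all z in X*_h̄ (existence is proved), as the claim fails for arbitrary subgradients when f̄ is nonsmooth at x*. *)

(* Defs.v *)
(* MathComp / MathComp-Analysis *)
From HB Require Import structures.
From mathcomp Require Import all_boot all_order all_algebra.
From mathcomp Require Import all_classical all_reals all_analysis.

Set Implicit Arguments.
Unset Strict Implicit.
Unset Printing Implicit Defensive.

Import Order.TTheory GRing.Theory Num.Theory.
Import numFieldNormedType.Exports.

Local Open Scope classical_set_scope.
Local Open Scope ring_scope.

(* The library norm on ['rV[R]_n] is the sup norm, so the Euclidean structure
   is introduced by hand.  The library topology, differential and partial
   derivatives do not depend on the choice of the norm and are used as is. *)
Section Euclidean.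
Context {R : realType} {n : nat}.
Implicit Types (x y z u : 'rV[R]_n) (X C : set 'rV[R]_n).

Definition dotp x y : R := \sum_(i < n) x 0 i * y 0 i.

Definition enorm x : R := Num.sqrt (dotp x x).

Definition edistance x X : R := inf [set enorm (x - z) | z in X].

Definition grad (f : 'rV[R]_n -> R) x : 'rV[R]_n :=
  \row_(i < n) 'D_(delta_mx 0 i) f x.

Definition smooth (L : R) (f : 'rV[R]_n -> R) : Prop :=
  (forall x, differentiable f x) /\
  (forall x y, enorm (grad f x - grad f y) <= L * enorm (x - y)).

Definition strongly_convex (mu : R) (f : 'rV[R]_n -> R) : Prop :=
  0 < mu /\
  forall x y (t : R), 0 <= t <= 1 ->
    f (t *: x + (1 - t) *: y) <=
    t * f x + (1 - t) * f y - mu / 2 * t * (1 - t) * enorm (x - y) ^+ 2.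

Definition affine_hull C : set 'rV[R]_n :=
  [set x | exists k (t : 'I_k -> R) (v : 'I_k -> 'rV[R]_n),
    [/\ forall i, C (v i), \sum_(i < k) t i = 1 & x = \sum_(i < k) t i *: v i]].

Definition rel_interior C : set 'rV[R]_n :=
  [set x | affine_hull C x /\
    exists2 e : R, 0 < e &
      [set y | affine_hull C y /\ enorm (y - x) <= e] `<=` C].

End Euclidean.

Section ExtendedValued.
Context {R : realType} {n : nat}.
Implicit Types (phi w : 'rV[R]_n -> \bar R) (X : set 'rV[R]_n).
Local Open Scope ereal_scope.

Definition dom w : set 'rV[R]_n := [set x | w x < +oo].

Definition proper_fun w : Prop := (forall x, -oo < w x) /\ dom w !=set0.

Definition epigraph w : set ('rV[R]_n * R) := [set p | w p.1 <= p.2%:E].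

Definition closed_fun w : Prop := closed (epigraph w).

(* Only used for functions that never take the value -oo; the library
   convention 0 * +oo = 0 makes the cases t = 0 and t = 1 harmless. *)
Definition econvex w : Prop :=
  forall x y (t : R), (0 <= t <= 1)%R ->
    w (t *: x + (1 - t) *: y)%R <= t%:E * w x + (1 - t)%:E * w y.

Definition argmin X phi : set 'rV[R]_n :=
  [set x | X x /\ forall y, X y -> phi x <= phi y].

Definition prox phi (z : 'rV[R]_n) : set 'rV[R]_n :=
  argmin setT (fun u => phi u + (2^-1 * enorm (u - z) ^+ 2)%:E).

Definition projection X (z : 'rV[R]_n) : set 'rV[R]_n :=
  argmin X (fun u => (enorm (u - z))%:E).

Definition subdifferential phi (x : 'rV[R]_n) : set 'rV[R]_n :=
  [set g | forall y, phi x + (dotp g (y - x))%:E <= phi y].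

(* The subgradients g of phi at x for which -g is normal to X at x: those that
   witness the first-order optimality condition 0 \in d phi(x) + N_X(x) for
   minimizing phi over X.  An arbitrary subgradient at a minimizer need not
   have this property when phi is not differentiable at x; it does when phi is
   differentiable there.  For f x = (x1^2 + x2^2) / 2,
   wf x = Num.max (2 x2) (x1 + x2), h = 0 and wh x = x2^2 / 2, the solution is
   0 and g = (1, 1) is a subgradient of f + wf at 0, but the lower bound
   f + wf >= - enorm g * edistance x X fails at the regularized solutions. *)
Definition optimality_subgradient phi X (x : 'rV[R]_n) : set 'rV[R]_n :=
  [set g | subdifferential phi x g /\
    forall y, X y -> (0 <= dotp g (y - x))%R].

Definition weak_sharp phi (alpha m : R) : Prop :=
  (0 < alpha)%R /\
  forall x, (alpha * edistance x (argmin setT phi) `^ m)%:E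
            <= phi x - ereal_inf (range phi).

End ExtendedValued.

Section Bilevel.
Context {R : realType} {n : nat}.
Implicit Types (f h : 'rV[R]_n -> R) (wf wh : 'rV[R]_n -> \bar R).

Definition composite f wf : 'rV[R]_n -> \bar R :=
  fun x => ((f x)%:E + wf x)%E.

Record bilevel_assumption f wf h wh (Lf muf Lh : R) (xs : 'rV[R]_n) : Prop := {
  f_smooth : smooth Lf f;
  f_strongly_convex : strongly_convex muf f;
  h_smooth : smooth Lh h;
  h_convex : convex_function setT h;
  wf_proper : proper_fun wf;
  wf_closed : closed_fun wf;
  wf_convex : econvex wf;
  wh_proper : proper_fun wh;
  wh_closed : closed_fun wh;
  wh_convex : econvex wh;
  lower_nonempty : argmin setT (composite h wh) !=set0;
  upper_bounded : (-oo < ereal_inf (range (composite f wf)))%E;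
  solution_unique :
    argmin (argmin setT (composite h wh)) (composite f wf) = [set xs];
  solution_interior : (dom wf)° xs;
  qualification :
    rel_interior (dom wf) `&` argmin setT (composite h wh) !=set0 }.

Definition condition_number (Lf muf Lh eta : R) : R :=
  (Lh + eta * Lf) / (eta * muf).

Record RVFISTA f wf h wh (Lf muf Lh eta : R) (x0 : 'rV[R]_n) (K : nat)
    (x y : nat -> 'rV[R]_n) : Prop := {
  init_x : x 0 = x0;
  init_y : y 0 = x0;
  step_x : forall k, (k < K)%N ->
    let gamma := (Lh + eta * Lf)^-1 in
    prox (fun u => gamma%:E * (wh u + eta%:E * wf u))%E
         (y k - gamma *: (grad h (y k) + eta *: grad f (y k)))
         (x k.+1);
  step_y : forall k, (k < K)%N ->
    let kappa := condition_number Lf muf Lh eta in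
    y k.+1 = x k.+1 + ((Num.sqrt kappa - 1) / (Num.sqrt kappa + 1))
                        *: (x k.+1 - x k) }.

End Bilevel.

(* Main.v *)
Require Import Defs.
From mathcomp Require Import all_boot all_order all_algebra.
From mathcomp Require Import all_classical all_reals all_analysis.
From mathcomp Require Import ring lra.
Import Order.TTheory GRing.Theory Num.Theory.
Import numFieldNormedType.Exports.
Local Open Scope classical_set_scope.
Local Open Scope ring_scope.

Set Implicit Arguments.
Unset Strict Implicit.
Unset Printing Implicit Defensive.

(* The FISTA energy argument never uses that the comparator minimizes the
   objective: for Phi = hbar + eta fbar, q = 1 - 1 / sqrt kappa and every z,
     Phi(x_K) - Phi(z) <= q^K (Phi(x_0) - Phi(z) + eta mu_f / 2 |x_0 - z|^2).
   The comparator z = x* bounds fbar(x_K) from above, z = x_0 gives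
   Phi(x_K) <= Phi(x_0), and z = the projection of x_0 bounds hbar(x_K).  The
   lower bounds come from a subgradient of fbar at x* whose opposite is normal
   to the lower-level solution set; it exists because x* is interior to
   dom wf.  When kappa = 1, q^K = 0 and the rate holds for arbitrary x_0: this
   covers u11 = +oo, where the library's 0 * +oo = 0 makes the bounds vanish. *)

(** Any comparator is allowed because the one-step inequality holds at every point of the domain,
    and chaining steps only multiplies by the nonnegative factor q. The price is that the initial
    gap at [xs] may be negative, so q^K cannot be enlarged freely in front of it. In the logarithmic
    regime, eta is tuned so that 1 / sqrt kappa >= (p + 1) ln K / K, which makes q^K at most
    K^-(p+1); dividing by eta, of order (ln K / K)^2, then costs two powers of K. In the weak sharp
    regime, the bound on eta keeps eta |g| dist below half of the lower-level gap. The subgradient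
    and its normality must be produced together, since a subgradient chosen alone need not be
    normal. A marginal function over translates of the feasible set encodes both conditions at once.
    Estimates are proved for real-valued functions on their domains; infinite values enter only at
    the end. *)

Section EuclideanTheory.
Context {R : realType} {n : nat}.
Implicit Types (x y z d : 'rV[R]_n) (a : R).

Lemma dotpC x y : dotp x y = dotp y x.
Proof. by apply: eq_bigr => i _; rewrite mulrC. Qed.

Lemma dotpDl x y z : dotp (x + y) z = dotp x z + dotp y z.
Proof. by rewrite -big_split; apply: eq_bigr => i _; rewrite mxE mulrDl. Qed.

Lemma dotpZl a x y : dotp (a *: x) y = a * dotp x y.
Proof. by rewrite /dotp mulr_sumr; apply: eq_bigr => i _; rewrite mxE mulrA. Qed.

Lemma dotpNl x y : dotp (- x) y = - dotp x y.
Proof. by rewrite -scaleN1r dotpZl mulN1r. Qed.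

Lemma dotpDr x y z : dotp x (y + z) = dotp x y + dotp x z.
Proof. by rewrite dotpC dotpDl !(dotpC _ x). Qed.

Lemma dotpZr a x y : dotp x (a *: y) = a * dotp x y.
Proof. by rewrite dotpC dotpZl dotpC. Qed.

Lemma dotpNr x y : dotp x (- y) = - dotp x y.
Proof. by rewrite dotpC dotpNl dotpC. Qed.

Definition dotpE := (dotpDl, dotpDr, dotpZl, dotpZr, dotpNl, dotpNr).

Lemma dotp0 x : dotp x 0 = 0.
Proof. by rewrite -(scale0r x) dotpZr mul0r. Qed.

Lemma dotpp_ge0 x : 0 <= dotp x x.
Proof. by apply: sumr_ge0 => i _; rewrite -expr2 sqr_ge0. Qed.

Lemma enorm_ge0 x : 0 <= enorm x.
Proof. exact: sqrtr_ge0. Qed.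

Lemma sqr_enorm x : enorm x ^+ 2 = dotp x x.
Proof. exact/sqr_sqrtr/dotpp_ge0. Qed.

Lemma enormN x : enorm (- x) = enorm x.
Proof. by rewrite /enorm !dotpE opprK. Qed.

Lemma enormB x y : enorm (x - y) = enorm (y - x).
Proof. by rewrite -enormN opprB. Qed.

Lemma enormZ a x : 0 <= a -> enorm (a *: x) = a * enorm x.
Proof.
by move=> a0; rewrite /enorm !dotpE mulrA sqrtrM ?sqr_ge0// -expr2 sqrtr_sqr ger0_norm.
Qed.

Lemma enorm_gt0 x : x != 0 -> 0 < enorm x.
Proof.
move=> x0; rewrite sqrtr_gt0 lt_def dotpp_ge0 andbT; apply: contra x0.
rewrite psumr_eq0 => [/allP xx0|i _]; last by rewrite -expr2 sqr_ge0.
apply/eqP/rowP => i; rewrite mxE; apply/eqP.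
by have := xx0 i (mem_index_enum i); rewrite -expr2 sqrf_eq0.
Qed.

Lemma dotp_le_enorm x y : dotp x y <= enorm x * enorm y.
Proof.
have [->|/enorm_gt0 x0] := eqVneq x 0.
  by rewrite dotpC dotp0 mulr_ge0 ?enorm_ge0.
have [->|/enorm_gt0 y0] := eqVneq y 0.
  by rewrite dotp0 mulr_ge0 ?enorm_ge0.
have := dotpp_ge0 (enorm y *: x - enorm x *: y).
rewrite !dotpE (dotpC y x) -!sqr_enorm => H.
have : 0 <= (enorm x * enorm y) * (enorm x * enorm y - dotp x y) by lra.
by rewrite pmulr_rge0 ?mulr_gt0// subr_ge0.
Qed.

Lemma edistance_le x (X : set 'rV[R]_n) z : X z -> edistance x X <= enorm (x - z).
Proof.
move=> Xz; apply: ge_inf; last by exists z.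
by exists 0 => _ [u _ <-]; exact: enorm_ge0.
Qed.

Lemma le_edistance x (X : set 'rV[R]_n) a :
  X !=set0 -> (forall z, X z -> a <= enorm (x - z)) -> a <= edistance x X.
Proof.
move=> [z Xz] aX; apply: lb_le_inf; first by exists (enorm (x - z)), z.
by move=> _ [u Xu <-]; exact: aX.
Qed.

End EuclideanTheory.

(** * Quadratic upper and lower models of smooth convex functions *)

Section SmoothFunctions.
Context {R : realType} {n : nat}.
Implicit Types (f : 'rV[R]_n -> R) (x y d : 'rV[R]_n).

Lemma derive_dotp f x d : differentiable f x -> 'D_d f x = dotp (grad f x) d.
Proof.
move=> df; rewrite deriveE// {1}(row_sum_delta d) linear_sum; apply: eq_bigr => i _.
by rewrite linearZ mxE deriveE//= mulrC.
Qed.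

Lemma is_derive_line f x d (t : R) : differentiable f (x + t *: d) ->
  is_derive t 1 (fun s : R => f (x + s *: d)) (dotp (grad f (x + t *: d)) d).
Proof.
move=> df; have dd := diff_derivable (v := d) df.
have E : (fun h : R =>
    h^-1 *: (((fun s : R => f (x + s *: d)) \o shift t) (h *: 1) - f (x + t *: d)))
  = (fun h => h^-1 *: ((f \o shift (x + t *: d)) (h *: d) - f (x + t *: d))).
  apply/funext => h /=; congr (_ *: (f _ - _)).
  by rewrite scalerDl -scalerA scale1r addrCA.
split; first by rewrite /derivable E.
by rewrite /derive E -derive_dotp.
Qed.

(** Only increments to the right of 0 are controlled, so the limit is taken there; the slack [b * t]
    absorbs the second-order term left by strong convexity. *)
Lemma is_derive_bound (phi : R -> R) (l b c : R) : is_derive (0 : R) (1 : R) phi l ->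
  (forall t, 0 < t <= 1 -> phi t - phi 0 <= t * (c + b * t)) -> l <= c.
Proof.
move=> [dphi <-] H.
have := @cvg_dnbhs_at_right _ _ _ _ _ dphi; move=> {}dphi.
have cv : (fun h : R => h^-1 *: ((phi \o shift 0) (h *: 1) - phi 0) - b * h) @ 0^'+
    --> 'D_1 phi 0 - b * 0.
  apply: cvgB => //.
  apply: cvgMr; exact: cvg_at_right_filter.
rewrite mulr0 subr0 in cv.
apply: (cvgr_to_le cv).
near=> h.
have h0 : 0 < h by [].
have h1 : h <= 1 by near: h; exact: nbhs_right_le.
have := H h; rewrite h0 h1 => /(_ isT) Hh /=.
rewrite addr0 /GRing.scale/= mulr1 lerBlDr.
by rewrite ler_pdivrMl// .
Unshelve. all: by end_near. Qed.

(** Along the segment, subtracting the claimed quadratic model leaves a function whose derivative is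
    nonpositive by Cauchy-Schwarz and the Lipschitz gradient; the mean value theorem takes the place
    of integration. *)
Lemma smooth_descent (L : R) f x y : smooth L f ->
  f y <= f x + dotp (grad f x) (y - x) + L / 2 * enorm (y - x) ^+ 2.
Proof.
move=> [df gL]; set d := y - x.
pose psi (t : R) := f (x + t *: d) - (t * dotp (grad f x) d + t ^+ 2 * (L / 2 * enorm d ^+ 2)).
pose dpsi (t : R) :=
  dotp (grad f (x + t *: d)) d - (dotp (grad f x) d + t * (L * enorm d ^+ 2)).
have dpsiE (t : R) : is_derive t (1 : R) psi (dpsi t).
  have ? := is_derive_line (df (x + t *: d)).
  apply: is_derive_eq.
  rewrite /dpsi /GRing.scale /= !mulr1 !mulr0 !add0r; by field.
have cpsi : {within `[0, 1], continuous psi}.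
  by apply: derivable_within_continuous => u _; have [] := dpsiE u.
have [t] := MVT_segment ler01 (fun t _ => dpsiE t) cpsi.
rewrite subr0 mulr1 {1}/psi scale1r {1}/psi scale0r addr0 (_ : x + d = y); last first.
  by rewrite /d addrC subrK.
rewrite in_itv => /andP[t0 _].
have : dpsi t <= 0.
  rewrite /dpsi opprD addrA -dotpNl -dotpDl subr_le0.
  apply: (le_trans (dotp_le_enorm _ _)).
  have := gL (x + t *: d) x; rewrite [x + _ - x]addrAC subrr add0r enormZ// => H.
  by have := ler_wpM2r (enorm_ge0 d) H; lra.
by move=> ? ?; lra.
Qed.

(** The convexity inequality bounds the difference quotients at [x] towards [y]. The sign of [mu] is
    free: [mu = 0] serves for [h], [muf] for [f]. *)
Lemma convex_gradient (mu : R) f x y : differentiable f x ->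
  (forall t, 0 <= t <= 1 -> f (t *: y + (1 - t) *: x) <=
     t * f y + (1 - t) * f x - mu / 2 * t * (1 - t) * enorm (y - x) ^+ 2) ->
  f x + dotp (grad f x) (y - x) + mu / 2 * enorm (y - x) ^+ 2 <= f y.
Proof.
move=> df fc; set d := y - x.
have dx : differentiable f (x + 0 *: d) by rewrite scale0r addr0.
have H := is_derive_line dx.
have : dotp (grad f (x + 0 *: d)) d <= f y - f x - mu / 2 * enorm d ^+ 2.
  apply: (@is_derive_bound _ _ (mu / 2 * enorm d ^+ 2) _ H) => t /andP[t0 t1].
  have := fc t; rewrite (ltW t0) t1 => /(_ isT).
  have -> : t *: y + (1 - t) *: x = x + t *: d.
    by rewrite scalerBl scale1r /d scalerBr addrCA.
  by rewrite scale0r addr0 -/d; lra.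
by rewrite scale0r addr0; lra.
Qed.

End SmoothFunctions.

(** * Linear minorants of sublinear functions *)

Section SublinearMinorant.
Context {R : realType} {n : nat}.
Implicit Types (p q : 'rV[R]_n -> R) (x y e : 'rV[R]_n).

Definition sublinear p :=
  (forall x y, p (x + y) <= p x + p y) /\
  (forall (t : R) x, 0 < t -> p (t *: x) = t * p x).

Lemma sublinear0 p : sublinear p -> p 0 = 0.
Proof. by move=> [_ /(_ 2 0)]; rewrite scaler0 => /(_ ltac:(lra)); lra. Qed.

Lemma sublinearN p x : sublinear p -> 0 <= p x + p (- x).
Proof. by move=> sp; rewrite -(sublinear0 sp) -(subrr x); apply: (sp.1). Qed.

Lemma sublinearZ p (t : R) x : sublinear p -> 0 <= t -> p (t *: x) = t * p x.
Proof.
move=> sp; rewrite le_eqVlt => /predU1P[<-|t0]; last exact: sp.2.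
by rewrite scale0r mul0r sublinear0.
Qed.

(* Lowering p to a sublinear function that is odd along e, one coordinate
   vector e after another, replaces the Hahn-Banach theorem. *)
Definition sublinear_dir p e x : R :=
  inf [set p (x + t *: e) - t * p e | t in [set t : R | 0 <= t]].

Section Direction.
Variables (p : 'rV[R]_n -> R) (e : 'rV[R]_n).
Hypothesis sp : sublinear p.

Lemma sublinear_dir_le x (t : R) : 0 <= t ->
  sublinear_dir p e x <= p (x + t *: e) - t * p e.
Proof.
move=> t0; apply: ge_inf; last by exists t.
(* Subadditivity applied to s e = (x + s e) + (- x) bounds the infimum from below. *)
exists (- p (- x)) => _ [s /= s0 <-].
rewrite -(sublinearZ e sp s0).
have := sp.1 (x + s *: e) (- x); rewrite addrAC subrr add0r; lra.
Qed.

Lemma le_sublinear_dir x (a : R) :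
  (forall t, 0 <= t -> a <= p (x + t *: e) - t * p e) -> a <= sublinear_dir p e x.
Proof.
move=> H; apply: lb_le_inf; first by exists (p (x + 0 *: e) - 0 * p e), 0 => //=.
by move=> _ [t /= t0 <-]; exact: H.
Qed.

Lemma sublinear_dir_sublinear : sublinear (sublinear_dir p e).
Proof.
split=> [x y|t x t0].
  rewrite -lerBlDr; apply: le_sublinear_dir => s s0.
  rewrite lerBlDr -lerBlDl; apply: le_sublinear_dir => t t0.
  have := sublinear_dir_le (x + y) (addr_ge0 s0 t0).
  have := sp.1 (x + s *: e) (y + t *: e).
  by rewrite addrACA -scalerDl; lra.
apply/eqP; rewrite eq_le; apply/andP; split.
  rewrite -ler_pdivrMl//; apply: le_sublinear_dir => s s0.
  rewrite ler_pdivrMl//.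
  have := sublinear_dir_le (t *: x) (mulr_ge0 (ltW t0) s0).
  by rewrite -scalerA -scalerDr sp.2//; lra.
apply: le_sublinear_dir => s s0.
have -> : s = t * (s / t) by rewrite mulrCA mulfV ?mulr1 ?gt_eqF.
rewrite -scalerA -scalerDr sp.2// -mulrA -mulrBr ler_pM2l//.
exact: sublinear_dir_le (divr_ge0 s0 (ltW t0)).
Qed.

Lemma sublinear_dir_le_id x : sublinear_dir p e x <= p x.
Proof. by have := sublinear_dir_le x (lexx 0); rewrite scale0r addr0 mul0r subr0. Qed.

Lemma sublinear_dirN : sublinear_dir p e (- e) <= - p e.
Proof.
by have := sublinear_dir_le (- e) ler01; rewrite scale1r addNr sublinear0// mul1r sub0r.
Qed.

End Direction.

(** Oddness along [e] survives all later lowering: any q below [sublinear_dir p e] satisfies q (- e)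
    <= - p e <= - q e. *)
Lemma sublinear_symmetrize p (s : seq 'rV[R]_n) : sublinear p ->
  exists q, [/\ sublinear q, forall x, q x <= p x & {in s, forall e, q (- e) <= - q e}].
Proof.
elim: s p => [|e s IH] p sp; first by exists p.
have [q [sq qp qs]] := IH _ (sublinear_dir_sublinear e sp).
exists q; split=> // [x|d].
  exact: le_trans (qp x) (sublinear_dir_le_id e sp x).
rewrite inE => /predU1P[->|/qs//].
have := le_trans (qp (- e)) (sublinear_dirN e sp).
have := le_trans (qp e) (sublinear_dir_le_id e sp e); lra.
Qed.

(** Once q is odd along the coordinate vectors, its values there define g. Subadditivity over
    coordinates gives q (- x) <= - <g, x>, and - q (- x) <= q x. *)
Lemma sublinear_minorant p : sublinear p -> exists g, forall x, dotp g x <= p x.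
Proof.
move=> sp; have [q [sq qp qs]] := sublinear_symmetrize [seq delta_mx 0 i | i <- enum 'I_n] sp.
exists (\row_i q (delta_mx 0 i)) => x.
apply: le_trans (qp x).
have H : q (- x) <= - dotp (\row_i q (delta_mx 0 i)) x.
  rewrite {1}(row_sum_delta x) /dotp -!sumrN.
  elim/big_ind2: _ => [|u a v b ua vb|i _]; first by rewrite sublinear0.
    by apply: le_trans (sq.1 _ _) _; exact: lerD.
  rewrite mxE.
  (* Oddness is needed for nonnegative coordinates; for negative ones positive homogeneity
     suffices. *)
  have [xi|xi] := leP 0 (x 0 i).
    rewrite -scalerN sublinearZ// (mulrC (q _)) -mulrN; apply: ler_wpM2l => //.
    by apply: qs; apply: map_f; rewrite mem_enum.
  by rewrite -scaleNr sublinearZ ?oppr_ge0 ?(ltW xi)// mulNr mulrC.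
by have := sublinearN x sq; lra.
Qed.

End SublinearMinorant.

(** Algebraic form of letting t tend to 0 in a first-order inequality already divided by t. *)
Lemma le_of_vanishing_slope {R : realFieldType} (a b c : R) : 0 <= c ->
  (forall t, 0 < t <= 1 -> a <= b + t * c) -> a <= b.
Proof.
move=> c0 H; rewrite leNgt; apply/negP => ab.
have d0 : 0 < a - b by rewrite subr_gt0.
have dc0 : 0 < a - b + c by rewrite ltr_wpDr.
(* With d = a - b > 0, this t = d / (d + c) lies in (0, 1] and has t c < d. *)
have := H ((a - b) / (a - b + c)).
rewrite divr_gt0// ler_pdivrMr// mul1r lerDl c0 => /(_ isT).
rewrite -lerBlDl mulrAC ler_pdivlMr// ler_pM2l//; lra.
Qed.

(** * Accelerated proximal gradient rate against an arbitrary comparator *)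

Section AcceleratedProximalGradient.
Context {R : realType} {n : nat}.
Variables (F W : 'rV[R]_n -> R) (G : 'rV[R]_n -> 'rV[R]_n) (D : set 'rV[R]_n).
Variables (L theta : R).
(** The strong convexity modulus, parametrized by theta = sqrt (sigma / L) to keep square roots out
    of the algebra. *)
Let sigma := L * theta ^+ 2.

Hypotheses (L_gt0 : 0 < L) (theta_gt0 : 0 < theta) (theta_le1 : theta <= 1).
Hypothesis F_upper : forall x y,
  F y <= F x + dotp (G x) (y - x) + L / 2 * enorm (y - x) ^+ 2.
Hypothesis F_lower : forall x y,
  F x + dotp (G x) (y - x) + sigma / 2 * enorm (y - x) ^+ 2 <= F y.
Hypothesis F_convex : forall x y (t : R), 0 <= t <= 1 ->
  F (t *: x + (1 - t) *: y) <=
  t * F x + (1 - t) * F y - sigma / 2 * t * (1 - t) * enorm (x - y) ^+ 2.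
Hypothesis W_convex : forall x y (t : R), D x -> D y -> 0 <= t <= 1 ->
  D (t *: x + (1 - t) *: y) /\
  W (t *: x + (1 - t) *: y) <= t * W x + (1 - t) * W y.

Implicit Types (x y z u v w : 'rV[R]_n).

Local Notation Phi u := (F u + W u).

(** The proximal condition multiplied by [L], with membership in [D] in place of infinite values. *)
Definition prox_grad_step y x : Prop :=
  D x /\ forall u, D u ->
    W x + L / 2 * enorm (x - (y - L^-1 *: G y)) ^+ 2 <=
    W u + L / 2 * enorm (u - (y - L^-1 *: G y)) ^+ 2.

(** Minimality of [x], tested along the segment towards [w], gives a variational inequality for [W].
    Adding the upper model from [y] to [x] and the lower model from [y] to [w] cancels all gradient
    terms. *)
Lemma prox_grad_ineq y x w : prox_grad_step y x -> D w ->
  Phi x + L / 2 * enorm (w - x) ^+ 2 <= Phi w + (L - sigma) / 2 * enorm (w - y) ^+ 2.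
Proof.
move=> [Dx xmin] Dw; 
(* Opaque names for the displacements, so that inner products expand over these two vectors only. *)
have [a aE] : {a | a = x - y} by exists (x - y).
have [e eE] : {e | e = w - x} by exists (w - x).
have H : W x - W w <= L * dotp a e + dotp (G y) e.
  apply: (@le_of_vanishing_slope _ _ _ (L / 2 * dotp e e)) => [|t /andP[t0 t1]].
    by rewrite mulr_ge0 ?dotpp_ge0// divr_ge0// ltW.
  have t01 : 0 <= t <= 1 by rewrite (ltW t0).
  have [Du Wu] := W_convex Dw Dx t01.
  have := xmin _ Du.
  have -> : x - (y - L^-1 *: G y) = a + L^-1 *: G y.
    by rewrite aE; apply/rowP => i; rewrite !mxE; ring.
  have -> : t *: w + (1 - t) *: x - (y - L^-1 *: G y) = (a + L^-1 *: G y) + t *: e.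
    by rewrite aE eE; apply/rowP => i; rewrite !mxE; ring.
  rewrite !sqr_enorm !dotpE (dotpC e a) (dotpC (G y) a) (dotpC e (G y)) => K.
  have LV : L * L^-1 = 1 by rewrite mulfV ?gt_eqF.
  have : t * (W x - W w) <=
      t * (L * dotp a e + (L * L^-1) * dotp (G y) e + t * (L / 2 * dotp e e)).
    lra.
  by rewrite ler_pM2l// LV mul1r.
have := F_upper y x; have := F_lower y w.
have -> : w - y = a + e by rewrite aE eE; apply/rowP => i; rewrite !mxE; ring.
rewrite -aE -eE !sqr_enorm !dotpE (dotpC e a); lra.
Qed.

(** [prox_grad_ineq] is used at w = theta z + (1 - theta) x, since w - x' is theta times z minus the
    new auxiliary point, and L theta^2 = sigma. When theta = 1, w is z itself, so x may lie outside
    [D]. *)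
Lemma accelerated_step x v x' z : D x \/ theta = 1 -> D z ->
  prox_grad_step (x + (theta / (1 + theta)) *: (v - x)) x' ->
  Phi x' - Phi z + sigma / 2 * enorm (z - (x + theta^-1 *: (x' - x))) ^+ 2 <=
  (1 - theta) * (Phi x - Phi z + sigma / 2 * enorm (z - v) ^+ 2).
Proof.
move=> Dx Dz step.
have t0 : theta != 0 by rewrite gt_eqF.
have t1 : 1 + theta != 0 by rewrite gt_eqF// addr_gt0.
pose w := theta *: z + (1 - theta) *: x.
have [a aE] : {a | a = z - x} by exists (z - x).
have [b bE] : {b | b = v - x} by exists (v - x).
have t01 : 0 <= theta <= 1 by rewrite ltW.
have wz : theta = 1 -> w = z.
  by move=> tE; rewrite /w tE subrr scale0r addr0 scale1r.
have Dw : D w.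
  by case: Dx => [Dx|/wz->//]; exact: (W_convex Dz Dx t01).1.
have Pw : Phi w <= theta * Phi z + (1 - theta) * Phi x
    - sigma / 2 * theta * (1 - theta) * dotp a a.
  case: Dx => [Dx|tE]; last by rewrite (wz tE) tE subrr mulr0 !mul0r subr0 mul1r addr0.
  have := (W_convex Dz Dx t01).2; have := F_convex z x t01.
  by rewrite -/w sqr_enorm -aE; lra.
have := prox_grad_ineq step Dw.
have wxE : w - x' = theta *: (z - (x + theta^-1 *: (x' - x))).
  by apply/rowP => i; rewrite !mxE; field.
have wyE : w - (x + (theta / (1 + theta)) *: (v - x)) =
    theta *: a - (theta / (1 + theta)) *: b.
  by rewrite aE bE; apply/rowP => i; rewrite !mxE; field.
have zvE : z - v = a - b by rewrite aE bE opprB addrA subrK.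
rewrite wxE wyE zvE (enormZ _ (ltW theta_gt0)) exprMn (sqr_enorm (a - b)).
rewrite (sqr_enorm (theta *: a - (theta / (1 + theta)) *: b)).
rewrite !dotpE (dotpC b a).
set N := enorm _ ^+ 2; set aa := dotp a a; set bb := dotp b b; set ab := dotp a b.
move=> H.
have bb0 : 0 <= sigma / 2 * (1 - theta) * (theta / (1 + theta)) * bb.
  by rewrite !mulr_ge0 ?subr_ge0 ?dotpp_ge0 ?invr_ge0 ?addr_ge0
    ?(ltW theta_gt0) ?(ltW L_gt0)// sqr_ge0.
(* With the strong convexity gain included, the quadratic terms differ by exactly a nonnegative
   multiple of |v - x|^2. *)
have E : (1 - theta) * (sigma / 2 * (aa - ab - (ab - bb)))
  + sigma / 2 * theta * (1 - theta) * aa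
  - (L - sigma) / 2 * (theta * (theta * aa - theta / (1 + theta) * ab)
     - theta / (1 + theta) * (theta * ab - theta / (1 + theta) * bb))
  = sigma / 2 * (1 - theta) * (theta / (1 + theta)) * bb by rewrite /sigma; field.
move: H E bb0 Pw; rewrite -/aa /sigma; set r := theta / _; lra.
Qed.

Variables (x y : nat -> 'rV[R]_n) (K : nat).
Hypothesis y_init : y 0 = x 0.
Hypothesis step_x : forall k, (k < K)%N -> prox_grad_step (y k) (x k.+1).
Hypothesis step_y : forall k, (k < K)%N ->
  y k.+1 = x k.+1 + ((1 - theta) / (1 + theta)) *: (x k.+1 - x k).

(** The auxiliary point of the energy: the last step stretched by 1 / theta. Moving from x_k by the
    fraction theta / (1 + theta) towards it reproduces the momentum coefficient. *)
Let v k := if k is k'.+1 then x k' + theta^-1 *: (x k - x k') else x 0.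

Let y_between k : (k <= K)%N -> y k = x k + (theta / (1 + theta)) *: (v k - x k).
Proof.
case: k => [_|k kK]; first by rewrite /v subrr scaler0 addr0.
have t0 : theta != 0 by rewrite gt_eqF.
have t1 : 1 + theta != 0 by rewrite gt_eqF// addr_gt0.
by rewrite step_y// /v; apply/rowP => i; rewrite !mxE; field; rewrite t0 t1.
Qed.

(** The energy of a non-minimizing z may be negative; the induction uses only 1 - theta >= 0. The
    final distance term is dropped. *)
Lemma accelerated_rate z : (0 < K)%N -> D (x 0) \/ theta = 1 -> D z ->
  Phi (x K) - Phi z <=
  (1 - theta) ^+ K * (Phi (x 0) - Phi z + sigma / 2 * enorm (z - x 0) ^+ 2).
Proof.
move=> K0 Dx0 Dz; pose E k := Phi (x k) - Phi z + sigma / 2 * enorm (z - v k) ^+ 2.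
have DxS k : (k < K)%N -> D (x k.+1) by move=> /step_x[].
have EK : forall k, (k <= K)%N -> E k <= (1 - theta) ^+ k * E 0.
  elim=> [_|k IH kK]; first by rewrite expr0 mul1r.
  have Dxk : D (x k) \/ theta = 1.
    case: Dx0 => [Dx0|]; [left|by right].
    by case: (k) kK => // k' /ltnW; exact: DxS.
  have := step_x kK; rewrite (y_between (ltnW kK)) => stepk.
  apply: (le_trans (accelerated_step Dxk Dz stepk)).
  by rewrite (exprS _ k) -(mulrA (1 - theta)) ler_wpM2l ?subr_ge0// IH// ltnW.
apply: le_trans (EK K (leqnn K)).
by rewrite lerDl mulr_ge0 ?sqr_ge0// divr_ge0// mulr_ge0 ?sqr_ge0// ltW.
Qed.

End AcceleratedProximalGradient.

(** * A subgradient whose opposite is normal to the feasible set *)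

Section OptimalitySubgradient.
Context {R : realType} {n : nat}.
Variables (phi : 'rV[R]_n -> R) (D X : set 'rV[R]_n) (xs : 'rV[R]_n).

Hypothesis phi_convex : forall x y (t : R), D x -> D y -> 0 <= t <= 1 ->
  D (t *: x + (1 - t) *: y) /\
  phi (t *: x + (1 - t) *: y) <= t * phi x + (1 - t) * phi y.
Hypothesis X_convex : forall x y (t : R), X x -> X y -> 0 <= t <= 1 ->
  X (t *: x + (1 - t) *: y).
Hypothesis Xxs : X xs.
Hypothesis xs_min : forall z, X z -> D z -> phi xs <= phi z.
Hypothesis xs_core : forall d, exists2 t : R, 0 < t & D (xs + t *: d).

(* The directional derivative at 0 of the convex marginal function
   [d |-> inf over z in X of phi (z + d)]; any linear minorant of it is a
   subgradient of phi at xs whose opposite is normal to X. *)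
Let slopes d : set R := [set r | exists t z,
  [/\ 0 < t, X z, D (z + t *: d) & r = (phi (z + t *: d) - phi xs) / t]].
Let p d : R := inf (slopes d).

Let combine x y (s t : R) : 0 < s -> 0 < t -> D x -> D y ->
  D ((s / (s + t)) *: x + (t / (s + t)) *: y) /\
  phi ((s / (s + t)) *: x + (t / (s + t)) *: y) <=
  (s / (s + t)) * phi x + (t / (s + t)) * phi y.
Proof.
move=> s0 t0 Dx Dy; have st0 : 0 < s + t by exact: addr_gt0.
have tE : t / (s + t) = 1 - s / (s + t) by field; rewrite gt_eqF.
rewrite tE; apply: phi_convex => //.
by rewrite divr_ge0 ?(ltW s0) ?(ltW st0)//= ler_pdivrMr// mul1r lerDl ltW.
Qed.

Let combineX x y (s t : R) : 0 < s -> 0 < t -> X x -> X y ->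
  X ((s / (s + t)) *: x + (t / (s + t)) *: y).
Proof.
move=> s0 t0 Dx Dy; have st0 : 0 < s + t by exact: addr_gt0.
have tE : t / (s + t) = 1 - s / (s + t) by field; rewrite gt_eqF.
rewrite tE; apply: X_convex => //.
by rewrite divr_ge0 ?(ltW s0) ?(ltW st0)//= ler_pdivrMr// mul1r lerDl ltW.
Qed.

(** A step s along - d from [xs] stays in [D]. Mixing it with z + t d, with weights that cancel the
    displacements, gives a point of X and D, where phi is at least phi xs. *)
Let has_lbound_slopes d : has_lbound (slopes d).
Proof.
have [s s0 Ds] := xs_core (- d).
exists (- ((phi (xs + s *: - d) - phi xs) / s)) => _ [t [z [t0 Xz Dt ->]]].
have st0 : 0 < s + t by exact: addr_gt0.
have [Dc] := combine s0 t0 Dt Ds.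
have cE : (s / (s + t)) *: (z + t *: d) + (t / (s + t)) *: (xs + s *: - d) =
    (s / (s + t)) *: z + (t / (s + t)) *: xs.
  by apply/rowP => i; rewrite !mxE; field; rewrite gt_eqF.
rewrite cE in Dc *; move=> phic.
have := le_trans (xs_min (combineX s0 t0 Xz Xxs) Dc) phic.
set a := phi (z + _); set b := phi (xs + _) => H.
have {}H : 0 <= s * (a - phi xs) + t * (b - phi xs).
  have := ler_wpM2l (ltW st0) H.
  suff -> : (s + t) * (s / (s + t) * a + t / (s + t) * b) = s * a + t * b by lra.
  by field; rewrite gt_eqF.
rewrite -subr_ge0 opprK.
have -> : (a - phi xs) / t + (b - phi xs) / s =
    (s * (a - phi xs) + t * (b - phi xs)) / (s * t).
  by field; rewrite !gt_eqF.
by rewrite divr_ge0// mulr_ge0// ltW.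
Qed.

Let p_le d z (t : R) : 0 < t -> X z -> D (z + t *: d) ->
  p d <= (phi (z + t *: d) - phi xs) / t.
Proof.
by move=> t0 Xz Dt; apply: ge_inf; [exact: has_lbound_slopes|exists t, z].
Qed.

Let le_p d (a : R) : (forall t z, 0 < t -> X z -> D (z + t *: d) ->
  a <= (phi (z + t *: d) - phi xs) / t) -> a <= p d.
Proof.
move=> H; apply: lb_le_inf; last by move=> _ [t [z [t0 Xz Dt ->]]]; exact: H.
by have [s s0 Ds] := xs_core d; exists ((phi (xs + s *: d) - phi xs) / s), s, xs.
Qed.

Let p_sublinear : sublinear p.
Proof.
split=> [d e|a d a0].
  rewrite -lerBlDr; apply: le_p => s z s0 Xz Ds.
  rewrite lerBlDr -lerBlDl; apply: le_p => t u t0 Xu Dt.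
  have st0 : 0 < t + s by exact: addr_gt0.
  have [Dc phic] := combine t0 s0 Ds Dt.
  have Xc := combineX t0 s0 Xz Xu.
  (* The weights t / (t + s) and s / (t + s) turn the steps s along d and t along e into this common
     length along d + e. *)
  have r0 : 0 < t * s / (t + s) by rewrite divr_gt0// mulr_gt0.
  have cE : (t / (t + s)) *: (z + s *: d) + (s / (t + s)) *: (u + t *: e) =
      ((t / (t + s)) *: z + (s / (t + s)) *: u) + (t * s / (t + s)) *: (d + e).
    by apply/rowP => i; rewrite !mxE; field; rewrite gt_eqF.
  rewrite cE in Dc phic.
  rewrite lerBlDr; apply: (le_trans (p_le r0 Xc Dc)).
  rewrite ler_pdivrMr//; move: phic; set A := phi (_ + _ *: (d + e)).
  set B := phi (z + _); set C := phi (u + _) => H.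
  apply: (@le_trans _ _ (t / (t + s) * B + s / (t + s) * C - phi xs)); first by rewrite lerB.
  rewrite le_eqVlt; apply/orP; left; apply/eqP; field.
  by rewrite !gt_eqF.
apply/eqP; rewrite eq_le; apply/andP; split.
  rewrite -ler_pdivrMl//; apply: le_p => t z t0 Xz Dt.
  rewrite ler_pdivrMl//.
  have E : (t / a) *: (a *: d) = t *: d by rewrite scalerA divfK ?gt_eqF.
  have := @p_le (a *: d) z (t / a) (divr_gt0 t0 a0) Xz.
  by rewrite E => /(_ Dt); rewrite invf_div mulrCA.
apply: le_p => t z t0 Xz; rewrite scalerA => Dt.
have := p_le (mulr_gt0 t0 a0) Xz Dt.
rewrite -(ler_pM2l a0); set r := phi _ - _ => /le_trans; apply.
by rewrite le_eqVlt; apply/orP; left; apply/eqP; field; rewrite !gt_eqF.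
Qed.

(** Slopes with t = 1 give <g, y - z> <= phi y - phi xs for y in D and z in X. Taking z = xs yields
    the subgradient inequality, y = xs the normality. *)
Lemma optimality_subgradient_real : exists g,
  (forall y, D y -> phi xs + dotp g (y - xs) <= phi y) /\
  (forall z, X z -> 0 <= dotp g (z - xs)).
Proof.
have [g gp] := sublinear_minorant p_sublinear; exists g.
have Dxs : D xs.
  have [s s0 Ds] := xs_core 0; by rewrite scaler0 addr0 in Ds.
have H y z : D y -> X z -> dotp g (y - z) <= phi y - phi xs.
  move=> Dy Xz; have E : z + 1 *: (y - z) = y by rewrite scale1r addrC subrK.
  have := le_trans (gp (y - z)) (@p_le (y - z) z 1 ltr01 Xz ltac:(by rewrite E)).
  by rewrite E divr1.
split=> [y Dy|z Xz]; first by have := H _ _ Dy Xxs; lra.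
by have := H _ _ Dxs Xz; rewrite subrr -opprB dotpNr; lra.
Qed.

End OptimalitySubgradient.

(** * Passage between extended-valued and real-valued functions *)

Section ExtendedRealGlue.
Context {R : realType} {n : nat}.
Implicit Types (f : 'rV[R]_n -> R) (w : 'rV[R]_n -> \bar R) (x y : 'rV[R]_n).

(** Meaningful on [dom w] only, since [fine] sends +oo to 0. *)
Definition rcomposite f w x : R := f x + fine (w x).

Lemma proper_fineK w x : proper_fun w -> dom w x -> w x = (fine (w x))%:E.
Proof. by move=> [wNy _] wx; rewrite fineK// fin_real// wNy. Qed.

Lemma rcompositeE f w x : proper_fun w -> dom w x ->
  composite f w x = (rcomposite f w x)%:E.
Proof. by move=> pw wx; rewrite /composite (proper_fineK pw wx). Qed.

Lemma composite_pinfty f w x : ~ dom w x -> composite f w x = +oo%E.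
Proof. by move=> /negP; rewrite -leNgt leye_eq /composite => /eqP ->. Qed.

Lemma composite_dom f w x : (composite f w x < +oo)%E -> dom w x.
Proof. by apply: contraPP => /composite_pinfty ->. Qed.

Lemma fine_convex w x y (t : R) : proper_fun w -> econvex w ->
  dom w x -> dom w y -> 0 <= t <= 1 ->
  dom w (t *: x + (1 - t) *: y) /\
  fine (w (t *: x + (1 - t) *: y)) <= t * fine (w x) + (1 - t) * fine (w y).
Proof.
move=> pw cw wx wy t01; have := cw x y t t01.
rewrite (proper_fineK pw wx) (proper_fineK pw wy) -!EFinM -EFinD => H.
have wt : dom w (t *: x + (1 - t) *: y) by exact: le_lt_trans H (ltry _).
by split=> //; move: H; rewrite (proper_fineK pw wt) lee_fin.
Qed.

End ExtendedRealGlue.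

(** * Consequences of the bilevel assumptions *)

Section BilevelFacts.
Context {R : realType} {n : nat}.
Variables (f : 'rV[R]_n -> R) (wf : 'rV[R]_n -> \bar R).
Variables (h : 'rV[R]_n -> R) (wh : 'rV[R]_n -> \bar R).
Variables (Lf muf Lh : R) (xs : 'rV[R]_n).
Hypothesis n_gt0 : (0 < n)%N.
Hypothesis A : bilevel_assumption f wf h wh Lf muf Lh xs.
Implicit Types (u v z g : 'rV[R]_n).

Local Notation fr := (rcomposite f wf).
Local Notation hr := (rcomposite h wh).
Local Notation Xh := (argmin setT (composite h wh)).

Let pf := wf_proper A.
Let ph := wh_proper A.

Lemma solution_argmin : argmin Xh (composite f wf) xs.
Proof. by rewrite (solution_unique A). Qed.

Lemma solution_feasible : Xh xs.
Proof. exact: solution_argmin.1. Qed.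

Lemma solution_wf : dom wf xs.
Proof. exact: interior_subset (solution_interior A). Qed.

Lemma Xh_dom z : Xh z -> dom wh z.
Proof.
move=> [_ zmin]; have [_ [u0 u0d]] := ph; apply: (@composite_dom _ _ h).
by apply: le_lt_trans (zmin u0 I) _; rewrite (rcompositeE _ ph u0d) ltry.
Qed.

Lemma hr_ge z u : Xh z -> dom wh u -> hr z <= hr u.
Proof.
move=> Xz ud; have := Xz.2 u I.
by rewrite (rcompositeE _ ph ud) (rcompositeE _ ph (Xh_dom Xz)) lee_fin.
Qed.

Lemma hr_Xh z : Xh z -> hr z = hr xs.
Proof.
move=> Xz; have Xs := solution_feasible.
by apply/eqP; rewrite eq_le !hr_ge//; exact: Xh_dom.
Qed.

Lemma mem_Xh u : dom wh u -> hr u <= hr xs -> Xh u.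
Proof.
move=> ud uxs; split=> // v _; apply: le_trans (solution_feasible.2 v I).
by rewrite (rcompositeE _ ph ud) (rcompositeE _ ph (Xh_dom solution_feasible)) lee_fin.
Qed.

Lemma lower_value : ereal_inf (range (composite h wh)) = (hr xs)%:E.
Proof.
rewrite -(rcompositeE _ ph (Xh_dom solution_feasible)).
apply/eqP; rewrite eq_le; apply/andP; split; first by apply: ereal_inf_lbound; exists xs.
by apply: le_ereal_inf_tmp => _ [u _ <-]; exact: solution_feasible.2.
Qed.

Lemma upper_inf : exists2 C : R, ereal_inf (range (composite f wf)) = C%:E &
  forall u, dom wf u -> C <= fr u.
Proof.
have lb u : (ereal_inf (range (composite f wf)) <= composite f wf u)%E.
  by apply: ereal_inf_lbound; exists u.
have fin : ereal_inf (range (composite f wf)) \is a fin_num.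
  rewrite fin_real// (upper_bounded A)/=; apply: le_lt_trans (lb xs) _.
  by rewrite (rcompositeE _ pf solution_wf) ltry.
exists (fine (ereal_inf (range (composite f wf)))); first by rewrite fineK.
by move=> u ud; have := lb u; rewrite -lee_fin fineK// -rcompositeE.
Qed.

Lemma h_convexity u v (t : R) : 0 <= t <= 1 ->
  h (t *: u + (1 - t) *: v) <= t * h u + (1 - t) * h v.
Proof.
move=> /andP[t0 t1].
exact: (h_convex A (Itv01 t0 t1) (in_setT u) (in_setT v)).
Qed.

Lemma Xh_convex u v (t : R) : Xh u -> Xh v -> 0 <= t <= 1 -> Xh (t *: u + (1 - t) *: v).
Proof.
move=> Xu Xv t01.
have [dw wc] := fine_convex ph (wh_convex A) (Xh_dom Xu) (Xh_dom Xv) t01.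
apply: mem_Xh => //; have := h_convexity u v t01.
have := hr_Xh Xu; have := hr_Xh Xv; rewrite /rcomposite.
by case/andP: t01 => t0 t1; nra.
Qed.

Lemma fr_convex u v (t : R) : dom wf u -> dom wf v -> 0 <= t <= 1 ->
  dom wf (t *: u + (1 - t) *: v) /\
  fr (t *: u + (1 - t) *: v) <=
    t * fr u + (1 - t) * fr v - muf / 2 * t * (1 - t) * enorm (u - v) ^+ 2.
Proof.
move=> du dv t01; have [dw wc] := fine_convex pf (wf_convex A) du dv t01.
by split=> //; have := (f_strongly_convex A).2 u v t t01; rewrite /rcomposite; lra.
Qed.

Lemma exists_optimality_subgradient :
  exists g, optimality_subgradient (composite f wf) Xh xs g.
Proof.
have mu0 := (f_strongly_convex A).1.
have [||||d|g [gsub gnor]] := @optimality_subgradient_real R n fr (dom wf) Xh xs.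
- move=> u v t du dv t01; have [dw wc] := fr_convex du dv t01; split=> //.
  apply: (le_trans wc); rewrite gerBl.
  case/andP: t01 => t0 t1.
  have m2 : 0 <= muf / 2 by lra.
  by apply: mulr_ge0; [apply: mulr_ge0; [exact: mulr_ge0|rewrite subr_ge0]|exact: sqr_ge0].
- exact: Xh_convex.
- exact: solution_feasible.
- move=> z Xz dz; have := solution_argmin.2 z Xz.
  by rewrite (rcompositeE _ pf dz) (rcompositeE _ pf solution_wf) lee_fin.
(* Topological interior implies algebraic interior: xs + t d tends to [xs] as t decreases to 0. *)
- have cv : (fun t : R => xs + t *: d) @ 0^'+ --> xs + 0 *: d.
    apply: cvgD; first exact: cvg_cst.
    by apply: cvgZr_tmp; exact: cvg_at_right_filter.
  rewrite scale0r addr0 in cv.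
  near (0 : R)^'+ => t; exists t => //.
  by near: t; exact: (cv _ (solution_interior A)).
exists g; split=> // u.
have [du|du] := pselect (dom wf u); last by rewrite (composite_pinfty _ du) leey.
by rewrite (rcompositeE _ pf du) (rcompositeE _ pf solution_wf) -EFinD lee_fin gsub.
Unshelve. all: by end_near. Qed.

(** The subgradient inequality at t u + (1 - t) xs is combined with strong convexity on that
    segment, divided by t, and t is sent to 0. *)
Lemma fr_subgradient_growth g u : subdifferential (composite f wf) xs g -> dom wf u ->
  dotp g (u - xs) + muf / 2 * enorm (u - xs) ^+ 2 <= fr u - fr xs.
Proof.
move=> sg du; have mu0 := (f_strongly_convex A).1.
rewrite -lerBrDr; apply: (@le_of_vanishing_slope _ _ _ (muf / 2 * enorm (u - xs) ^+ 2)).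
  by rewrite mulr_ge0 ?sqr_ge0// divr_ge0// ltW.
move=> t /andP[t0 t1].
have t01 : 0 <= t <= 1 by rewrite (ltW t0).
have [dt ft] := fr_convex du solution_wf t01.
have := sg (t *: u + (1 - t) *: xs).
rewrite (rcompositeE _ pf dt) (rcompositeE _ pf solution_wf) -EFinD lee_fin.
have -> : t *: u + (1 - t) *: xs - xs = t *: (u - xs).
  by apply/rowP => i; rewrite !mxE; ring.
rewrite dotpZr => H; rewrite -(ler_pM2l t0); lra.
Qed.

(** For each feasible z, u - xs = (z - xs) - (z - u): normality signs the first part and
    Cauchy-Schwarz bounds the second. The infimum over z needs no nearest point; g = 0 is separate
    because the norm of g is divided out. *)
Lemma fr_lower_bound g u : optimality_subgradient (composite f wf) Xh xs g -> dom wf u ->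
  - enorm g * edistance u Xh + muf / 2 * enorm (u - xs) ^+ 2 <= fr u - fr xs.
Proof.
move=> [sg gnor] du; apply: le_trans (fr_subgradient_growth sg du); rewrite lerD2r.
rewrite mulNr lerNl.
have H z : Xh z -> - dotp g (u - xs) <= enorm g * enorm (u - z).
  move=> Xz; have := dotp_le_enorm g (z - u); rewrite enormB.
  have -> : u - xs = (z - xs) - (z - u) by apply/rowP => i; rewrite !mxE; ring.
  by rewrite (dotpDr g (z - xs)) dotpNr; have := gnor z Xz; lra.
have := enorm_ge0 g; rewrite le_eqVlt => /predU1P[g0|g0].
  by have := H _ solution_feasible; rewrite -g0 !mul0r.
rewrite -ler_pdivrMl//; apply: le_edistance; first by exists xs; exact: solution_feasible.
by move=> z Xz; rewrite ler_pdivrMl// H.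
Qed.

(** A nonzero vector, available because n > 0, compares the quadratic models of [f] and signs the
    Lipschitz constant of [h]. The order muf <= Lf yields kappa >= 1. *)
Lemma curvature_bounds : [/\ 0 < muf, muf <= Lf & 0 <= Lh].
Proof.
have mu0 := (f_strongly_convex A).1.
pose e : 'rV[R]_n := const_mx 1.
have e0 : 0 < enorm (e - 0).
  rewrite enorm_gt0// subr0; apply/eqP => /rowP /(_ (Ordinal n_gt0)).
  by rewrite !mxE => /eqP; rewrite oner_eq0.
split=> //.
  have := smooth_descent 0 e (f_smooth A).
  have := @convex_gradient _ _ muf f 0 e ((f_smooth A).1 0)
    (fun t => (f_strongly_convex A).2 e 0 t).
  have := exprn_gt0 2 e0; set N := _ ^+ 2 => N0 ? ?.
  have : muf * N <= Lf * N by lra.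
  by rewrite ler_pM2r.
have := (h_smooth A).2 e 0.
by move=> /(le_trans (enorm_ge0 _)); rewrite pmulr_lge0.
Qed.

Lemma projection_distance z u : projection Xh z u -> enorm (u - z) = edistance z Xh.
Proof.
move=> [Xu umin]; apply/eqP; rewrite eq_le; apply/andP; split.
  apply: le_edistance; first by exists u.
  by move=> v /umin; rewrite lee_fin (enormB v).
by rewrite enormB; exact: edistance_le.
Qed.

(** * The iterates as accelerated proximal gradient steps on the regularized objective *)

Section Iterates.
Variables (eta : R) (x0 : 'rV[R]_n) (K : nat) (x y : nat -> 'rV[R]_n).
Hypothesis eta_gt0 : 0 < eta.
Hypothesis Alg : RVFISTA f wf h wh Lf muf Lh eta x0 K x y.
Hypothesis K_gt0 : (0 < K)%N.

Let L := Lh + eta * Lf.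
Let kappa := condition_number Lf muf Lh eta.
Let theta := 1 / Num.sqrt kappa.
Let D : set 'rV[R]_n := [set u | dom wf u /\ dom wh u].
Let F u := h u + eta * f u.
Let W u := fine (wh u) + eta * fine (wf u).
Let G u := grad h u + eta *: grad f u.

Let L_gt0 : 0 < L.
Proof.
have [mu0 muL Lh0] := curvature_bounds.
by rewrite /L ltr_wpDl// mulr_gt0// (lt_le_trans mu0).
Qed.

Lemma condition_number_ge1 : 1 <= kappa.
Proof.
have [mu0 muL Lh0] := curvature_bounds.
rewrite /kappa /condition_number ler_pdivlMr ?mulr_gt0// mul1r.
by have := ler_wpM2l (ltW eta_gt0) muL; lra.
Qed.

Let kappa_gt0 : 0 < kappa. Proof. exact: lt_le_trans condition_number_ge1. Qed.

Let theta_gt0 : 0 < theta. Proof. by rewrite divr_gt0// sqrtr_gt0. Qed.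

Let theta_le1 : theta <= 1.
Proof.
by rewrite ler_pdivrMr ?sqrtr_gt0// mul1r -sqrtr1 ler_wsqrtr// condition_number_ge1.
Qed.

(** Identifies the abstract modulus with that of h + eta f, since kappa = L / (eta muf). *)
Let sigmaE : L * theta ^+ 2 = eta * muf.
Proof.
have [mu0 _ _] := curvature_bounds.
rewrite /theta expr_div_n sqr_sqrtr ?(ltW kappa_gt0)// expr1n /kappa /condition_number -/L.
by field; rewrite !gt_eqF.
Qed.

Let step_prox k : (k < K)%N -> prox_grad_step W G D L (y k) (x k.+1).
Proof.
move=> kK; have := step_x Alg kK; rewrite /= -/L -/(G _).
set c := y k - _; move=> [_ xmin]; have Li : 0 < L^-1 by rewrite invr_gt0.
have val u : D u -> (L^-1%:E * (wh u + eta%:E * wf u) + (2^-1 * enorm (u - c) ^+ 2)%:E)%E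
    = (L^-1 * W u + 2^-1 * enorm (u - c) ^+ 2)%:E.
  by move=> [uf uh]; rewrite (proper_fineK pf uf) (proper_fineK ph uh).
have Dxs : D xs by split; [exact: solution_wf|exact/Xh_dom/solution_feasible].
have Dx : D (x k.+1).
  (* The proximal objective is finite at [xs], hence at its minimizer, which excludes every infinite
     value of [wf] and [wh]. *)
  have := xmin xs I; rewrite (val _ Dxs) => /le_lt_trans /(_ (ltry _)).
  rewrite /D /dom /=.
  have := pf.1 (x k.+1); have := ph.1 (x k.+1).
  case: (wf _) => [a| |]//; case: (wh _) => [b| |]// _ _.
  - by rewrite addye// gt0_muley ?lte_fin// addye// ltxx.
  - by rewrite gt0_muley ?lte_fin// addey// gt0_muley ?lte_fin// addye// ltxx.
  - by rewrite gt0_muley ?lte_fin// addye// gt0_muley ?lte_fin// addye// ltxx.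
split=> // u Du; have := xmin u I.
rewrite (val _ Du) (val _ Dx) lee_fin -(ler_pM2l L_gt0) !mulrDr !mulrA mulfV ?gt_eqF//.
by rewrite !mul1r.
Qed.

Let D_convex u v (t : R) : D u -> D v -> 0 <= t <= 1 ->
  D (t *: u + (1 - t) *: v) /\ W (t *: u + (1 - t) *: v) <= t * W u + (1 - t) * W v.
Proof.
move=> [uf uh] [vf vh] t01.
have [df cf] := fine_convex pf (wf_convex A) uf vf t01.
have [dh ch] := fine_convex ph (wh_convex A) uh vh t01.
split=> //; rewrite /W; have := ler_wpM2l (ltW eta_gt0) cf; lra.
Qed.

Lemma iterate_dom : dom wf (x K) /\ dom wh (x K).
Proof. by case: K K_gt0 step_prox => // k _ /(_ k (ltnSn k)) []. Qed.

Lemma regularized_rate z : dom wf z -> dom wh z ->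
  (dom wf x0 /\ dom wh x0) \/ 1 - theta = 0 ->
  hr (x K) + eta * fr (x K) - (hr z + eta * fr z) <=
  (1 - theta) ^+ K * (hr x0 + eta * fr x0 - (hr z + eta * fr z)
     + eta * muf / 2 * enorm (x0 - z) ^+ 2).
Proof.
move=> zf zh x0D.
have PE u : F u + W u = hr u + eta * fr u by rewrite /F /W /rcomposite; ring.
rewrite -!PE -(init_x Alg) (enormB _ z) -sigmaE.
apply: (@accelerated_rate _ _ F W G D L theta _ _ _ _ _ _ _ x y K) => //.
- move=> u v; have := smooth_descent u v (f_smooth A).
  have := smooth_descent u v (h_smooth A).
  by rewrite /F /G /L dotpDl dotpZl => H1 /(ler_wpM2l (ltW eta_gt0)); lra.
- move=> u v; rewrite sigmaE.
  have := @convex_gradient _ _ muf f u v ((f_smooth A).1 u)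
    (fun t => (f_strongly_convex A).2 v u t).
  have : h u + dotp (grad h u) (v - u) + 0 / 2 * enorm (v - u) ^+ 2 <= h v.
    apply: convex_gradient ((h_smooth A).1 u) _ => t t01.
    by rewrite !mul0r subr0 h_convexity.
  rewrite !mul0r addr0 => H1.
  by rewrite /F /G dotpDl dotpZl => /(ler_wpM2l (ltW eta_gt0)); lra.
- move=> u v t t01; rewrite sigmaE /F; have := h_convexity u v t01.
  by have := ler_wpM2l (ltW eta_gt0) ((f_strongly_convex A).2 u v t t01); lra.
- by rewrite (init_x Alg) (init_y Alg).
- move=> k kK; rewrite (step_y Alg kK) -/kappa; congr (_ + _ *: _).
  have s0 : 0 < Num.sqrt kappa by rewrite sqrtr_gt0.
  by rewrite /theta; field; rewrite !gt_eqF// addr_gt0.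
- by rewrite (init_x Alg); case: x0D => [|t1]; [left|right; lra].
Qed.

End Iterates.
End BilevelFacts.

(** * Arithmetic of the logarithmic regularization parameter *)

Section LogarithmicStepSize.
Context {R : realType}.
Implicit Types (p etabar eta mu Lf Lh : R) (K : nat).

(** From ln (1 + t) <= t at t = 1 / K - 1. With p > 2 it makes (p + 1) ln K at least 1. *)
Lemma ln_nat_ge_half K : (2 <= K)%N -> 2^-1 <= ln (K%:R : R).
Proof.
move=> K2; have k2 : (2 : R) <= K%:R by rewrite ler_nat.
have k0 : (0 : R) < K%:R by exact: lt_le_trans k2.
have ki : (K%:R : R)^-1 <= 2^-1 by rewrite lef_pV2 ?posrE.
have ki0 : (0 : R) < K%:R^-1 by rewrite invr_gt0.
have := @le_ln1Dx R (K%:R^-1 - 1) ltac:(lra).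
rewrite addrCA subrr addr0 lnV ?posrE//; lra.
Qed.

(** The formula vanishes at K = 0, by the convention 0^-1 = 0, and at K = 1, where ln 1 = 0;
    positivity of eta excludes both. *)
Lemma log_step_ge2 K eta (c d : R) : 0 < eta ->
  eta = c * (d * ln (K%:R : R) / K%:R) ^+ 2 -> (2 <= K)%N.
Proof.
case: K => [|[|K]]// e0 eE; move: e0; rewrite eE.
  by rewrite invr0 mulr0 expr0n mulr0 ltxx.
by rewrite ln1 mulr0 mul0r expr0n mulr0 ltxx.
Qed.

Lemma powR_shift (p k : R) : 0 < k ->
  k `^ (p + 1) = k ^+ 2 * k `^ (p - 1) /\ k `^ (p + 3) = k ^+ 2 * k `^ (p + 1).
Proof.
move=> k0; have kN0 : k != 0 by rewrite gt_eqF.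
by split; rewrite -powR_mulrn ?(ltW k0)// -powRD ?kN0 ?implybT//; congr (_ `^ _); lra.
Qed.

Variables (p etabar eta mu Lf Lh : R) (K : nat).
Hypotheses (p_gt2 : 2 < p) (etabar_gt0 : 0 < etabar) (eta_gt0 : 0 < eta).
Hypotheses (mu_gt0 : 0 < mu) (mu_le : mu <= Lf) (Lh_ge0 : 0 <= Lh).
Let k : R := K%:R.
Let L := Lh + etabar * Lf.
Hypothesis etaE : eta = L / mu * ((p + 1) * ln k / k) ^+ 2.
Hypothesis K_large : L * (p + 1) ^+ 2 / (mu * etabar) <= (k / ln k) ^+ 2.

Let K_ge2 : (2 <= K)%N. Proof. exact: log_step_ge2 eta_gt0 etaE. Qed.
Let k_gt1 : 1 < k. Proof. by rewrite ltr1n. Qed.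
Let k_gt0 : 0 < k. Proof. exact: lt_trans k_gt1. Qed.
Let lnk_ge : 2^-1 <= ln k. Proof. exact: ln_nat_ge_half. Qed.
Let lnk_gt0 : 0 < ln k. Proof. exact: ln_gt0. Qed.
Let p1_gt0 : 0 < p + 1. Proof. by have := p_gt2; lra. Qed.

Lemma log_step_modulus_gt0 : 0 < L.
Proof. by rewrite /L ltr_wpDl// mulr_gt0// (lt_le_trans mu_gt0). Qed.
Let L_gt0 := log_step_modulus_gt0.

(** The largeness condition on K is this inequality rearranged. *)
Lemma log_step_le : eta <= etabar.
Proof.
move: K_large; rewrite ler_pdivrMr ?mulr_gt0// => H.
rewrite etaE -(ler_pM2r (mulr_gt0 mu_gt0 (exprn_gt0 2 (divr_gt0 k_gt0 lnk_gt0)))).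
have -> : L / mu * ((p + 1) * ln k / k) ^+ 2 * (mu * (k / ln k) ^+ 2) = L * (p + 1) ^+ 2.
  by field; rewrite !gt_eqF.
by lra.
Qed.

(** With s = (p + 1) ln K / K, eta <= etabar gives kappa <= s^-2. Hence q <= 1 - s <= exp (- s), and
    exp (- s K) = K^-(p+1). *)
Lemma log_step_decay : 0 <= 1 - 1 / Num.sqrt (condition_number Lf mu Lh eta) ->
  (1 - 1 / Num.sqrt (condition_number Lf mu Lh eta)) ^+ K <= (k `^ (p + 1))^-1.
Proof.
set kappa := condition_number _ _ _ _ => q0.
pose s := (p + 1) * ln k / k.
have s0 : 0 < s by rewrite divr_gt0// mulr_gt0.
have Le0 : 0 < Lh + eta * Lf by rewrite ltr_wpDl// mulr_gt0// (lt_le_trans mu_gt0).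
have kap0 : 0 < kappa by rewrite divr_gt0// mulr_gt0.
have kap : kappa <= s^-1 ^+ 2.
  have -> : s^-1 ^+ 2 = L / (eta * mu).
    by rewrite [in RHS]etaE -/s; field; rewrite !gt_eqF.
  rewrite ler_pM2r ?invr_gt0 ?mulr_gt0// lerD2l ler_pM2r ?log_step_le//.
  exact: lt_le_trans mu_le.
have sk : s <= 1 / Num.sqrt kappa.
  have sq0 : 0 < Num.sqrt kappa by rewrite sqrtr_gt0.
  rewrite ler_pdivlMr// mulrC -ler_pdivlMr// mul1r.
  by rewrite -(ger0_norm (ltW (eqbRL (invr_gt0 s) s0))) -sqrtr_sqr ler_wsqrtr.
have -> : (k `^ (p + 1))^-1 = expR (- s) ^+ K.
  rewrite -expRM_natr /powR gt_eqF// -expRN mulNr; congr (expR (- _)).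
  by rewrite /s -/k; field; rewrite gt_eqF.
apply: lerXn2r; rewrite ?nnegrE ?expR_ge0//.
by apply: le_trans (expR_ge1Dx _); rewrite lerD2l lerN2.
Qed.

(** The two sides differ exactly by the factor (p + 1) ln K, which is at least 1. *)
Lemma log_step_weight :
  (eta * k `^ (p + 1))^-1 <= mu / (L * (p + 1)) / (k `^ (p - 1) * ln k).
Proof.
have [-> _] := powR_shift p k_gt0; set P := k `^ (p - 1).
have P0 : 0 < P by exact: powR_gt0.
have -> : (eta * (k ^+ 2 * P))^-1 =
    mu / (L * (p + 1)) / (P * ln k) / ((p + 1) * ln k).
  by rewrite etaE; field; rewrite !gt_eqF.
rewrite ler_pdivrMr ?mulr_gt0// ler_peMr//.
  by apply: ltW; rewrite !divr_gt0// mulr_gt0.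
have : 0 <= (p - 2) * ln k by rewrite mulr_ge0 ?(ltW lnk_gt0)// subr_ge0 ltW.
by have := lnk_ge; lra.
Qed.

End LogarithmicStepSize.

(** * Real-valued bounds in the two regimes *)

Section RegularizedBounds.
Context {R : realType} {n : nat}.
Variables (f : 'rV[R]_n -> R) (wf : 'rV[R]_n -> \bar R).
Variables (h : 'rV[R]_n -> R) (wh : 'rV[R]_n -> \bar R).
Variables (Lf muf Lh : R) (xs : 'rV[R]_n).
Hypothesis n_gt0 : (0 < n)%N.
Hypothesis A : bilevel_assumption f wf h wh Lf muf Lh xs.
Variables (eta : R) (x0 : 'rV[R]_n) (K : nat) (x y : nat -> 'rV[R]_n).
Hypothesis eta_gt0 : 0 < eta.
Hypothesis Alg : RVFISTA f wf h wh Lf muf Lh eta x0 K x y.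

Local Notation fr := (rcomposite f wf).
Local Notation hr := (rcomposite h wh).
Local Notation Xh := (argmin setT (composite h wh)).
Local Notation q := (1 - 1 / Num.sqrt (condition_number Lf muf Lh eta)).

Let mu_gt0 : 0 < muf. Proof. by have [] := curvature_bounds n_gt0 A. Qed.
Let mu_le : muf <= Lf. Proof. by have [] := curvature_bounds n_gt0 A. Qed.
Let Lh_ge0 : 0 <= Lh. Proof. by have [] := curvature_bounds n_gt0 A. Qed.

Lemma contraction_ge0 : 0 <= q.
Proof.
have k1 := condition_number_ge1 n_gt0 A eta_gt0.
have s1 : 1 <= Num.sqrt (condition_number Lf muf Lh eta).
  by rewrite -sqrtr1 ler_wsqrtr.
by rewrite subr_ge0 ler_pdivrMr ?mul1r// (lt_le_trans ltr01).
Qed.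

Section LogarithmicRegularization.
Variables (etabar p : R).
Hypotheses (etabar_gt0 : 0 < etabar) (p_gt2 : 2 < p).
Let k : R := K%:R.
Let L := Lh + etabar * Lf.
Hypothesis etaE : eta = L / muf * ((p + 1) * ln k / k) ^+ 2.
Hypothesis K_large : L * (p + 1) ^+ 2 / (muf * etabar) <= (k / ln k) ^+ 2.
Hypothesis x0_dom : dom wf x0 /\ dom wh x0.

Let K_ge2 : (2 <= K)%N. Proof. exact: log_step_ge2 eta_gt0 etaE. Qed.
Let K_gt0 : (0 < K)%N. Proof. exact: ltnW. Qed.
Let k_ge1 : 1 <= k. Proof. by rewrite ler1n. Qed.
Let k_gt0 : 0 < k. Proof. exact: lt_le_trans k_ge1. Qed.
Let P := k `^ (p + 1).
Let P_gt0 : 0 < P. Proof. exact: powR_gt0. Qed.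
Let P_inv_le1 : P^-1 <= 1.
Proof.
rewrite invf_le1// -[leLHS](powRr0 k) ler_powR//.
by have := p_gt2; lra.
Qed.
Let decay : q ^+ K <= P^-1.
Proof.
exact: (log_step_decay p_gt2 etabar_gt0 eta_gt0 mu_gt0 mu_le Lh_ge0 etaE K_large
  contraction_ge0).
Qed.
Let xK_hr : hr xs <= hr (x K).
Proof. exact: (hr_ge A (solution_feasible A) (iterate_dom n_gt0 A eta_gt0 Alg K_gt0).2). Qed.

(* The gap [G] at xs need not be nonnegative, since xs does not minimize the
   regularized objective; when it is negative, the rate is replaced by the
   monotonicity x0 -> x K, i.e. by the rate with x0 itself as comparator. *)
Lemma log_step_suboptimality :
  fr (x K) - fr xs <= (fr x0 - fr xs + muf / 2 * enorm (x0 - xs) ^+ 2) / P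
    + muf * (hr x0 - hr xs) / (L * (p + 1)) / (k `^ (p - 1) * ln k).
Proof.
have rate z (zf : dom wf z) (zh : dom wh z) :=
  regularized_rate n_gt0 A eta_gt0 Alg K_gt0 zf zh (or_introl x0_dom).
have descent := rate x0 x0_dom.1 x0_dom.2.
rewrite !subrr add0r sqr_enorm dotp0 !mulr0 in descent.
have rs := rate xs (solution_wf A) (Xh_dom A (solution_feasible A)).
have x0_hr : 0 <= hr x0 - hr xs.
  by rewrite subr_ge0; exact: (hr_ge A (solution_feasible A) x0_dom.2).
set N := enorm _ ^+ 2 in rs *; have N0 : 0 <= N by exact: sqr_ge0.
set G := (X in _ <= _ * X) in rs.
have GP : hr (x K) + eta * fr (x K) - (hr xs + eta * fr xs) <= P^-1 * G.
  have [G0|G0] := leP 0 G; first by apply: le_trans rs _; exact: ler_wpM2r.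
  apply: (@le_trans _ _ G).
    have : 0 <= eta * muf / 2 * N.
      by apply: mulr_ge0 => //; apply: divr_ge0 => //; exact/ltW/mulr_gt0.
    by rewrite /G; lra.
  (* A negative G only increases when multiplied by P^-1 <= 1. *)
  have : (1 - P^-1) * G <= 0 by rewrite mulr_ge0_le0 ?subr_ge0// ltW.
  by lra.
have etaP0 : 0 < (eta * P)^-1 by rewrite invr_gt0 mulr_gt0.
have weight := log_step_weight p_gt2 etabar_gt0 eta_gt0 mu_gt0 mu_le Lh_ge0 etaE.
have GE : P^-1 * G =
    eta * ((fr x0 - fr xs + muf / 2 * N) / P + (hr x0 - hr xs) * (eta * P)^-1).
  by rewrite /G; field; rewrite !gt_eqF.
have main : fr (x K) - fr xs <=
    (fr x0 - fr xs + muf / 2 * N) / P + (hr x0 - hr xs) * (eta * P)^-1.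
  by rewrite -(ler_pM2l eta_gt0) -GE; have := xK_hr; lra.
apply: (le_trans main); rewrite lerD2l.
apply: (le_trans (ler_wpM2l x0_hr weight)).
by rewrite -/L -/k !mulrA [_ * muf]mulrC.
Qed.

(** The projection has optimal lower-level value and realizes the distance from x0. Bounding the
    remaining upper-level values below by C makes the bracket B nonnegative, so q^K may be replaced
    by P^-1. *)
Lemma log_step_infeasibility (px0 : 'rV[R]_n) (C : R) :
  projection Xh x0 px0 -> dom wf px0 -> (forall u, dom wf u -> C <= fr u) ->
  hr (x K) - hr xs <=
    (fr px0 - C) * (L * (p + 1) ^+ 2) / muf * (ln k / k) ^+ 2
    + L * (p + 1) ^+ 2 * (fr x0 - C + 2^-1 * muf * edistance x0 Xh ^+ 2) / muf
      * ln k ^+ 2 / k `^ (p + 3)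
    + (hr x0 - hr xs) / P.
Proof.
move=> proj px0f Cle; have Xpx0 := proj.1.
have := regularized_rate n_gt0 A eta_gt0 Alg K_gt0 px0f (Xh_dom A Xpx0)
  (or_introl x0_dom).
rewrite (hr_Xh A Xpx0) enormB (projection_distance proj).
set N := edistance _ _ ^+ 2; have N0 : 0 <= N by exact: sqr_ge0.
have Cp := Cle _ px0f; have C0 := Cle _ x0_dom.1.
have CK := Cle _ (iterate_dom n_gt0 A eta_gt0 Alg K_gt0).1.
have x0_hr : 0 <= hr x0 - hr xs.
  by rewrite subr_ge0; exact: (hr_ge A (solution_feasible A) x0_dom.2).
have Q0 : 0 <= q ^+ K by rewrite exprn_ge0// contraction_ge0.
set B := hr x0 - hr xs + eta * (fr x0 - C + 2^-1 * muf * N).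
have B0 : 0 <= B.
  rewrite addr_ge0// mulr_ge0 ?(ltW eta_gt0)// addr_ge0 ?subr_ge0//.
  by apply: mulr_ge0 => //; apply: mulr_ge0 (ltW mu_gt0); rewrite invr_ge0.
move=> rate.
have {}rate : hr (x K) - hr xs <= eta * (fr px0 - C) + P^-1 * B.
  apply: (@le_trans _ _ (eta * (fr px0 - C) + q ^+ K * B)); last first.
    by rewrite lerD2l ler_wpM2r.
  have H1 := ler_wpM2l (ltW eta_gt0) Cp.
  have H2 := ler_wpM2l (ltW eta_gt0) CK.
  have H3 := ler_wpM2l Q0 H1.
  by rewrite /B; lra.
apply: (le_trans rate).
have [_ ->] := powR_shift p k_gt0.
rewrite le_eqVlt; apply/orP; left; apply/eqP.
rewrite /B etaE -/k -/P; field.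
by rewrite !gt_eqF.
Qed.

End LogarithmicRegularization.

Lemma weak_sharp_dist (g u : 'rV[R]_n) (alpha m : R) :
  weak_sharp (composite h wh) alpha m -> 1 <= m -> dom wh u ->
  enorm g * edistance u Xh <= enorm g / alpha `^ m^-1 * (hr u - hr xs) `^ m^-1.
Proof.
move=> [alpha0 ws] m1 du; have m0 : 0 < m by exact: lt_le_trans m1.
have := ws u; rewrite (lower_value A) (rcompositeE _ (wh_proper A) du) -EFinB lee_fin => H.
have d0 : 0 <= edistance u Xh.
  apply: le_edistance; first by exists xs; exact: solution_feasible A.
  by move=> z _; exact: enorm_ge0.
rewrite -mulrA ler_wpM2l ?enorm_ge0// ler_pdivlMl ?powR_gt0//.
have {1}-> : edistance u Xh = (edistance u Xh `^ m) `^ m^-1.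
  by rewrite -powRrM mulfV ?gt_eqF// powRr1.
rewrite -powRM ?powR_ge0 ?(ltW alpha0)//.
apply: ge0_ler_powR => //; rewrite ?nnegrE ?invr_ge0 ?(ltW m0)//.
  by rewrite mulr_ge0 ?powR_ge0// ltW.
by rewrite subr_ge0; exact: (hr_ge A (solution_feasible A)).
Qed.

(* Exact penalization: the error in fr allowed by the subgradient bound is
   absorbed by half of the lower-level gap. *)
Lemma sharp_bounds (alpha Z : R) (g : 'rV[R]_n) : (0 < K)%N ->
  weak_sharp (composite h wh) alpha 1 ->
  optimality_subgradient (composite f wf) Xh xs g ->
  eta * (2 * enorm g) <= alpha ->
  hr (x K) + eta * fr (x K) - (hr xs + eta * fr xs) <= eta * Z ->
  [/\ 0 <= hr (x K) - hr xs, hr (x K) - hr xs <= 2 * eta * Z,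
      edistance (x K) Xh <= 2 * eta * Z / alpha,
      - Z <= fr (x K) - fr xs <= Z &
      enorm (x K - xs) ^+ 2 <= 4 * Z / muf].
Proof.
move=> K_gt0 [alpha0 ws] og ag rate.
have [df dh] := iterate_dom n_gt0 A eta_gt0 Alg K_gt0.
have := ws (x K); rewrite (lower_value A) (rcompositeE _ (wh_proper A) dh) -EFinB lee_fin.
have d0 : 0 <= edistance (x K) Xh.
  apply: le_edistance; first by exists xs; exact: solution_feasible A.
  by move=> z _; exact: enorm_ge0.
rewrite powRr1// => sharp.
have lower := fr_lower_bound A og df.
have g0 := enorm_ge0 g.
have hK : 0 <= hr (x K) - hr xs.
  by rewrite subr_ge0; exact: (hr_ge A (solution_feasible A) dh).
set N := enorm _ ^+ 2 in lower *; have N0 : 0 <= N by exact: sqr_ge0.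
set d := edistance _ _ in lower sharp d0 *.
have gd : eta * (2 * (enorm g * d)) <= hr (x K) - hr xs.
  by have := ler_wpM2r d0 ag; lra.
have muN : 0 <= muf * N by rewrite mulr_ge0// ltW.
have emuN : 0 <= eta * (muf * N) by rewrite mulr_ge0// ltW.
have elower := ler_wpM2l (ltW eta_gt0) lower.
(* The penalty eta |g| d, at most half the gap, is absorbed on the left; this is the origin of the
   factor 2. *)
have hle : hr (x K) - hr xs + eta * (muf * N) <= 2 * (eta * Z) by lra.
have hle' : hr (x K) - hr xs <= 2 * (eta * Z) by lra.
have Nle : muf * N <= 2 * Z by rewrite -(ler_pM2l eta_gt0); lra.
have gdZ : enorm g * d <= Z by rewrite -(ler_pM2l eta_gt0); lra.
split=> //.
- by rewrite -mulrA.
- by rewrite ler_pdivlMr// [d * _]mulrC -mulrA (le_trans sharp).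
- apply/andP; split; first by lra.
  by rewrite -(ler_pM2l eta_gt0); lra.
- by rewrite ler_pdivlMr// mulrC; lra.
Qed.

End RegularizedBounds.

Local Open Scope ereal_scope.

(** * Upper bounds that become infinite outside the domains *)

Section ExtendedBounds.
Context {R : realType}.
Implicit Types (X Y Z : \bar R) (a c C d e fs hs l P r s : R).

Lemma EFin_div a r : (0 < r)%R -> a%:E / r%:E = (a / r)%:E.
Proof. by move=> r0; rewrite inver gt_eqF. Qed.

Lemma pinfty_div r : (0 < r)%R -> +oo / r%:E = +oo.
Proof. by move=> r0; rewrite inver gt_eqF// gt0_mulye// lte_fin invr_gt0. Qed.

Lemma pinfty_mul r : (0 < r)%R -> +oo * r%:E = +oo.
Proof. by move=> r0; rewrite gt0_mulye// lte_fin. Qed.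

Lemma mul_pinfty r : (0 < r)%R -> r%:E * +oo = +oo.
Proof. by move=> r0; rewrite gt0_muley// lte_fin. Qed.

Let pinftyE := (@addye R, @addey R, mul_pinfty, pinfty_mul, pinfty_div).

Lemma suboptimality_bound_pinfty X Y fs hs c d l P r :
  (0 < d)%R -> (0 < l)%R -> (0 < P)%R -> (0 < r)%R ->
  -oo < X -> -oo < Y -> X = +oo \/ Y = +oo ->
  (X - fs%:E + c%:E) / P%:E + d%:E * (Y - hs%:E) / l%:E / r%:E = +oo.
Proof.
move=> d0 l0 P0 r0; case: X => [X| |]//; case: Y => [Y| |]//.
all: move=> _ _ H; try by case: H.
(* Finite subterms collapse into single reals, leaving only +oo to propagate through positive
   factors. *)
all: do 5 rewrite -?EFinB -?EFinD -?EFinM ?EFin_div//.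
all: by rewrite !pinftyE.
Qed.

Lemma infeasibility_bound_pinfty X Y Z a C c d l hs P r s :
  (0 < d)%R -> (0 < l)%R -> (0 < c)%R -> (0 < s)%R -> (0 < P)%R -> (0 < r)%R ->
  -oo < X -> -oo < Y -> -oo < Z -> [\/ X = +oo, Y = +oo | Z = +oo] ->
  (Z - C%:E) * l%:E / d%:E * c%:E + l%:E * (X - C%:E + a%:E) / d%:E * s%:E / r%:E
    + (Y - hs%:E) / P%:E = +oo.
Proof.
move=> d0 l0 c0 s0 P0 r0; case: X => [X| |]//; case: Y => [Y| |]//; case: Z => [Z| |]//.
all: move=> _ _ _ H; try by case: H.
all: do 5 rewrite -?EFinB -?EFinD -?EFinM ?EFin_div//.
all: by rewrite !pinftyE.
Qed.

Lemma sharp_bound_pinfty X Y fs hs c e s : (0 < e)%R -> (0 < s)%R ->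
  -oo < X -> -oo < Y -> X = +oo \/ Y = +oo ->
  (X - fs%:E + (Y - hs%:E) / e%:E + c%:E) * s%:E = +oo.
Proof.
move=> e0 s0; case: X => [X| |]//; case: Y => [Y| |]//.
all: move=> _ _ H; try by case: H.
all: do 5 rewrite -?EFinB -?EFinD -?EFinM ?EFin_div//.
all: by rewrite !pinftyE.
Qed.

End ExtendedBounds.

(** * Both regimes, with infinite values included *)

Theorem corollary3 (R : realType) (n : nat) (n_gt0 : (0 < n)%N)
  (f : 'rV[R]_n -> R) (wf : 'rV[R]_n -> \bar R)
  (h : 'rV[R]_n -> R) (wh : 'rV[R]_n -> \bar R)
  (Lf muf Lh : R) (xs : 'rV[R]_n)
  (A : bilevel_assumption f wf h wh Lf muf Lh xs) :
  let fbar := composite f wf in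
  let hbar := composite h wh in
  let Xh := argmin setT hbar in
  let fstar := fbar xs in
  let hstar := ereal_inf (range hbar) in
  let Chat := ereal_inf (range fbar) in
  (exists g, optimality_subgradient fbar Xh xs g) /\
  forall (x0 : 'rV[R]_n) (K : nat) (eta : R) (x y : nat -> 'rV[R]_n),
  (0 < eta)%R ->
  RVFISTA f wf h wh Lf muf Lh eta x0 K x y ->
  (forall (etabar p : R) (px0 : 'rV[R]_n),
    (0 < etabar)%R -> (2 < p)%R ->
    projection Xh x0 px0 ->
    let k : R := K%:R in
    let L : R := (Lh + etabar * Lf)%R in
    eta = (L / muf * ((p + 1) * ln k / k) ^+ 2)%R ->
    (L * (p + 1) ^+ 2 / (muf * etabar) <= (k / ln k) ^+ 2)%R ->
    let u6 := fbar x0 - fstar + (muf / 2 * enorm (x0 - xs) ^+ 2)%:E in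
    let u7 := muf%:E * (hbar x0 - hstar) / (L * (p + 1))%:E in
    let u8 := (fbar px0 - Chat) * (L * (p + 1) ^+ 2)%:E / muf%:E in
    let u9 := (L * (p + 1) ^+ 2)%:E
              * (fbar x0 - Chat + (2^-1 * muf * edistance x0 Xh ^+ 2)%:E)
              / muf%:E in
    let u10 := hbar x0 - hstar in
    let RK := u8 * ((ln k / k) ^+ 2)%:E
              + u9 * (ln k ^+ 2)%:E / (k `^ (p + 3))%:E
              + u10 / (k `^ (p + 1))%:E in
    let UK := u6 / (k `^ (p + 1))%:E + u7 / (k `^ (p - 1) * ln k)%:E in
    ((forall g, optimality_subgradient fbar Xh xs g ->
       (- enorm g * edistance (x K) Xh
        + muf / 2 * enorm (x K - xs) ^+ 2)%:E <= fbar (x K) - fstar)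
     /\ fbar (x K) - fstar <= UK) /\
    (0 <= hbar (x K) - hstar /\ hbar (x K) - hstar <= RK) /\
    (forall g (alpha m : R), optimality_subgradient fbar Xh xs g ->
       (1 <= m)%R -> weak_sharp hbar alpha m ->
       let E := (enorm g / alpha `^ m^-1)%:E * RK `^ m^-1 in
       (muf / 2 * enorm (x K - xs) ^+ 2)%:E <= UK + E /\
       - E <= fbar (x K) - fstar)) /\
  (* the bound on eta is eta <= alpha / (2 * enorm g), without the quotient so
     that g = 0 imposes no restriction *)
  (forall (alpha : R) (g : 'rV[R]_n),
    weak_sharp hbar alpha 1 ->
    optimality_subgradient fbar Xh xs g ->
    (eta * (2 * enorm g) <= alpha)%R ->
    (1 <= K)%N ->
    let u11 := fbar x0 - fstar + (hbar x0 - hstar) / eta%:E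
               + (muf * enorm (x0 - xs) ^+ 2 / 2)%:E in
    let q : R := (1 - 1 / Num.sqrt (condition_number Lf muf Lh eta))%R in
    (0 <= hbar (x K) - hstar /\
     hbar (x K) - hstar <= (2 * eta)%:E * u11 * (q ^+ K)%:E) /\
    (edistance (x K) Xh)%:E <= (2 * eta)%:E * u11 / alpha%:E * (q ^+ K)%:E /\
    (- u11 * (q ^+ K)%:E <= fbar (x K) - fstar /\
     fbar (x K) - fstar <= u11 * (q ^+ K)%:E) /\
    (enorm (x K - xs) ^+ 2)%:E <= 4%:E * u11 / muf%:E * (q ^+ K)%:E).
Proof.
have [mu0 muL Lh0] := curvature_bounds n_gt0 A.
have pf := wf_proper A; have ph := wh_proper A.
move=> fbar hbar Xh fstar hstar Chat.
split; first exact: exists_optimality_subgradient A.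
move=> x0 K eta x y eta0 Alg.
have fbarNy u : -oo < fbar u.
  have [du|/composite_pinfty du] := pselect (dom wf u).
    by rewrite /fbar rcompositeE// ltNyr.
  by rewrite /fbar du.
have hbarNy u : -oo < hbar u.
  have [du|/composite_pinfty du] := pselect (dom wh u).
    by rewrite /hbar rcompositeE// ltNyr.
  by rewrite /hbar du.
have infinite_x0 : ~ (dom wf x0 /\ dom wh x0) -> fbar x0 = +oo \/ hbar x0 = +oo.
  move=> /not_andP[] /composite_pinfty H; [left|right]; exact: H.
have fstarE : fstar = (rcomposite f wf xs)%:E by exact: rcompositeE pf (solution_wf A).
have hstarE : hstar = (rcomposite h wh xs)%:E by exact: (lower_value A).
have [C ChatE Cle] := upper_inf A; rewrite -/fbar -/Chat in ChatE.
have hgap u : dom wh u -> 0 <= hbar u - hstar.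
  move=> du; rewrite /hbar rcompositeE// hstarE -EFinB lee_fin subr_ge0.
  exact: (hr_ge A (solution_feasible A) du).
split.
  move=> etabar p px0 etabar0 p2 proj k L etaE K_large u6 u7 u8 u9 u10 RK UK.
  have K2 : (2 <= K)%N by exact: (log_step_ge2 eta0 etaE).
  have K0 : (0 < K)%N by exact: ltnW.
  have k1 : (1 < k)%R by rewrite /k ltr1n.
  have k0 : (0 < k)%R by exact: lt_trans k1.
  have lnk0 : (0 < ln k)%R by exact: ln_gt0.
  have p1 : (0 < p + 1)%R by lra.
  have L0 : (0 < L)%R by exact: (@log_step_modulus_gt0 _ etabar muf Lf Lh).
  have Lp0 : (0 < L * (p + 1) ^+ 2)%R by rewrite mulr_gt0// exprn_gt0.
  have Lp10 : (0 < L * (p + 1))%R by rewrite mulr_gt0.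
  have lk20 : (0 < ln k ^+ 2)%R by rewrite exprn_gt0.
  have P1 r : (0 < k `^ r)%R by exact: powR_gt0.
  have Pl : (0 < k `^ (p - 1) * ln k)%R by rewrite mulr_gt0.
  have lkk : (0 < (ln k / k) ^+ 2)%R by rewrite exprn_gt0// divr_gt0.
  have [fK hK] := iterate_dom n_gt0 A eta0 Alg K0.
  have fgapE : fbar (x K) - fstar = (rcomposite f wf (x K) - rcomposite f wf xs)%:E.
    by rewrite /fbar rcompositeE// fstarE -EFinB.
  have hgapE : hbar (x K) - hstar = (rcomposite h wh (x K) - rcomposite h wh xs)%:E.
    by rewrite /hbar rcompositeE// hstarE -EFinB.
  have lower g : optimality_subgradient fbar Xh xs g ->
      (- enorm g * edistance (x K) Xh + muf / 2 * enorm (x K - xs) ^+ 2)%:E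
      <= fbar (x K) - fstar.
    by move=> og; rewrite fgapE lee_fin; exact: (fr_lower_bound A og fK).
  have upper : fbar (x K) - fstar <= UK.
    rewrite fgapE /UK /u6 /u7 fstarE hstarE.
    have [x0d|/infinite_x0 x0d] := pselect (dom wf x0 /\ dom wh x0); last first.
      by rewrite suboptimality_bound_pinfty// leey.
    rewrite /fbar /hbar (rcompositeE _ pf x0d.1) (rcompositeE _ ph x0d.2).
    do 5 rewrite -?EFinB -?EFinD -?EFinM ?EFin_div//.
    rewrite lee_fin.
    exact: (log_step_suboptimality n_gt0 A eta0 Alg etabar0 p2 etaE K_large x0d).
  have infeasibility : hbar (x K) - hstar <= RK.
    rewrite hgapE /RK /u8 /u9 /u10 ChatE hstarE.
    have [x0d|/infinite_x0 x0d] := pselect (dom wf x0 /\ dom wh x0); last first.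
      rewrite infeasibility_bound_pinfty ?leey//.
      by case: x0d => ?; [constructor 1|constructor 2].
    have [pd|/composite_pinfty pd] := pselect (dom wf px0); last first.
      by rewrite infeasibility_bound_pinfty ?leey//; constructor 3; exact: pd.
    rewrite /fbar /hbar (rcompositeE _ pf x0d.1) (rcompositeE _ ph x0d.2).
    rewrite (rcompositeE _ pf pd).
    do 6 rewrite -?EFinB -?EFinD -?EFinM ?EFin_div//.
    rewrite lee_fin.
    exact: (log_step_infeasibility n_gt0 A eta0 Alg etabar0 p2 etaE K_large x0d proj pd Cle).
  split; [split=> //; exact: lower|split; [split=> //; exact: hgap|]].
  move=> g alpha m og m1 ws E.
  have m0 : (0 <= m^-1)%R by rewrite invr_ge0 (le_trans ler01).
  (* Weak sharpness bounds the distance by a root of the lower-level gap; monotonicity of the root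
     then replaces the gap by [RK], finite or not. *)
  have gE : (enorm g * edistance (x K) Xh)%:E <= E.
    apply: (@le_trans _ _ ((enorm g / alpha `^ m^-1)%:E * (hbar (x K) - hstar) `^ m^-1)).
      by rewrite hgapE poweR_EFin -EFinM lee_fin; exact: (weak_sharp_dist A g ws m1 hK).
    apply: lee_wpmul2l; first by rewrite lee_fin divr_ge0 ?enorm_ge0 ?powR_ge0.
    apply: gt0_ler_poweR => //; rewrite in_itv/= leey andbT; first exact: hgap.
    exact: le_trans (hgap _ hK) infeasibility.
  have := lower g og; rewrite fgapE lee_fin => lower_g.
  split.
    apply: le_trans (leeD upper gE); rewrite fgapE -EFinD lee_fin; lra.
  rewrite leeNl; apply: le_trans gE; rewrite -EFinN lee_fin.
  have : (0 <= muf / 2 * enorm (x K - xs) ^+ 2)%R.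
    by apply: mulr_ge0 (sqr_ge0 _); apply: divr_ge0 => //; exact: ltW.
  lra.
move=> alpha g ws og ag K0 u11 q.
have [fK hK] := iterate_dom n_gt0 A eta0 Alg K0.
have fgapE : fbar (x K) - fstar = (rcomposite f wf (x K) - rcomposite f wf xs)%:E.
  by rewrite /fbar rcompositeE// fstarE -EFinB.
have hgapE : hbar (x K) - hstar = (rcomposite h wh (x K) - rcomposite h wh xs)%:E.
  by rewrite /hbar rcompositeE// hstarE -EFinB.
have alpha0 := ws.1.
have hK0 := hgap _ hK.
(* All bounds are rewritten as multiples of the single quantity u11 q^K, on which the case split
   below is made. *)
have -> : (2 * eta)%:E * u11 * (q ^+ K)%:E = (2 * eta)%:E * (u11 * (q ^+ K)%:E).
  by rewrite muleA.
have -> : (2 * eta)%:E * u11 / alpha%:E * (q ^+ K)%:E =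
    (2 * eta / alpha)%:E * (u11 * (q ^+ K)%:E).
  by rewrite -EFin_div// !muleA; congr (_ * _); rewrite muleAC.
have -> : 4%:E * u11 / muf%:E * (q ^+ K)%:E = (4 / muf)%:E * (u11 * (q ^+ K)%:E).
  by rewrite -EFin_div// !muleA; congr (_ * _); rewrite muleAC.
rewrite mulNe.
have q0 : (0 <= q)%R by exact: (contraction_ge0 n_gt0 A eta0).
have rate := regularized_rate n_gt0 A eta0 Alg K0 (solution_wf A)
  (Xh_dom A (solution_feasible A)).
(* Either the bounds are infinite and trivial, or u11 q^K is a real Z fit for [sharp_bounds]. For q
   = 0 one takes Z = 0, as K >= 1; for q > 0 finiteness requires x0 in both domains. *)
have [uq|[Z ZE HZ]] : u11 * (q ^+ K)%:E = +oo \/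
    exists2 Z : R, u11 * (q ^+ K)%:E = Z%:E &
    (rcomposite h wh (x K) + eta * rcomposite f wf (x K)
     - (rcomposite h wh xs + eta * rcomposite f wf xs) <= eta * Z)%R.
  have [qE|qN0] := eqVneq q 0%R.
    right; exists 0%R; first by rewrite qE expr0n gtn_eqF// mule0.
    by have := rate (or_intror qE); rewrite -/q qE expr0n gtn_eqF//= mul0r mulr0.
  have qK0 : (0 < q ^+ K)%R by rewrite exprn_gt0// lt_def qN0.
  have [x0d|/infinite_x0 x0d] := pselect (dom wf x0 /\ dom wh x0); last first.
    by left; rewrite /u11 fstarE hstarE sharp_bound_pinfty.
  right; exists ((rcomposite f wf x0 - rcomposite f wf xs
      + (rcomposite h wh x0 - rcomposite h wh xs) / eta
      + muf * enorm (x0 - xs) ^+ 2 / 2) * q ^+ K)%R.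
    rewrite /u11 /fbar /hbar (rcompositeE _ pf x0d.1) (rcompositeE _ ph x0d.2) fstarE hstarE.
    by do 3 rewrite -?EFinB -?EFinD -?EFinM ?EFin_div//.
  apply: (le_trans (rate (or_introl x0d))); rewrite -/q.
  by rewrite le_eqVlt; apply/orP; left; apply/eqP; field; rewrite gt_eqF.
  have e2 : (0 < 2 * eta)%R by exact: mulr_gt0.
  by rewrite uq !mul_pinfty ?divr_gt0//= !leey leNye hK0.
rewrite ZE -EFinN -!EFinM fgapE hgapE !lee_fin.
have [? ? ? /andP[? ?] ?] := sharp_bounds n_gt0 A eta0 Alg K0 ws og ag HZ.
by do !split=> //; rewrite mulrAC.
Qed.
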